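(* Let $\mathcal{C}(\mathcal{Z})$ be the discrete cluster category associated to an admissible subset $\mathcal{Z}\subseteq S^1$ with limit points $a_1<\dots<a_n$, $n\ge2$. Let $(\mathcal{X},\mathcal{Y})$ be a t-structure in $\mathcal{C}(\mathcal{Z})$ associated to a $\overline{\mathcal{Z}}$-decorated non-crossing partition $(\mathcal{P},\mathbf{x})$ with $\mathbf{x}=(x_1,\ldots,x_n)$ (i.e. $\mathcal{X}=\mathcal{X}(\mathcal{P},\mathbf{x})$). Then: - $(\mathcal{X},\mathcal{Y})$ is left non-degenerate if and only if for every $i\in[n]$ either $x_i\in\mathcal{Z}$ or $x_i=a_i$; - $(\mathcal{X},\mathcal{Y})$ is right non-degenerate if and only if for every $i\in[n]$ either $x_i\in\mathcal{Z}$ or $x_i=a_{i+1}$; - $(\mathcal{X},\mathcal{Y})$ is non-degenerate if and only if $x_i\in\mathcal{Z}$ for every $i\in[n]$, i.e. if and only if the heart of $(\mathcal{X},\mathcal{Y})$ is isomorphic to the module category of the product of $n$ copies of $\mathbb{K}$.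
   Context: **Combinatorial setting.** $\mathbb{K}$ is a field. $S^1$ is the unit circle with anti-clockwise cyclic order: for pairwise distinct $x,y,z\in S^1$, $x<y<z$ means that going anti-clockwise one meets first $x$, then $y$, then $z$; for $m\ge 3$, $x_1<\dots<x_m$ means $x_i<x_{i+1}<x_{i+2}$ for all $i$ (indices modulo $m$). $\mathcal{Z}\subseteq S^1$ is admissible: discrete, infinite, with set of limit points $L(\mathcal{Z})=\overline{\mathcal{Z}}\setminus\mathcal{Z}$ ($\overline{\mathcal{Z}}$ the topological closure) finite of cardinality $n$ (here $n\geq 2$), every limit point being a two-sided limit point. The limit points are $a_1<\dots<a_n$, indices modulo $n$ (so $a_{n+1}=a_1$). For $a,b\in\overline{\mathcal{Z}}$, $(a,b)=\{c\in\overline{\mathcal{Z}}\mid a<c<b\}$, and $[a,b],[a,b),(a,b]$ are defined analogously as subsets of $\overline{\mathcal{Z}}$; $(a,a]=\varnothing$. Each $z\in\mathcal{Z}$ has an immediate successor $z^+$ and predecessor $z^-$ in $\mathcal{Z}$ (anti-clockwise, resp. clockwise neighbour). An arc of $\mathcal{Z}$ is a 2-element subset $\{z_0,z_1\}\subseteq\mathcal{Z}$ with $z_1\notin\{z_0^-,z_0,z_0^+\}$. Arcs $\{y_0,y_1\},\{y_0',y_1'\}$ cross if $y_0<y_0'<y_1<y_1'$ or $y_0<y_1'<y_1<y_0'$. **The category.** $\mathcal{C}(\mathcal{Z})$ is the discrete cluster category of Igusa–Todorov: a $\mathbb{K}$-linear, 2-Calabi–Yau, Krull–Schmidt triangulated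 category with suspension $\Sigma$ whose non-zero indecomposable objects correspond to arcs of $\mathcal{Z}$ (same notation for arc and object), with: - $\Sigma\{y_0,y_1\}=\{y_0^-,y_1^-\}$; - $\mathrm{Hom}(\{y_0,y_1\},\Sigma\{y_0',y_1'\})=\mathbb{K}$ if the arcs $\{y_0,y_1\}$ and $\{y'_0,y'_1\}$ cross, and $0$ otherwise; - a non-zero morphism $\{y_0,y_1\}\to\{y_0',y_1'\}$ with $y_0<y_0'^+<y_1<y_1'^+$ factors through an indecomposable $S$ iff $S=\{s_0,s_1\}$ with $y_0\le s_0\le y_0'$ and $y_1\le s_1\le y_1'$; - if $y_0<y_0'<y_1<y_1'$, every non-zero $f:\{y_0,y_1\}\to\Sigma\{y_0',y_1'\}$ sits in a triangle $\{y_0',y_1'\}\to X\oplus Z\to\{y_0,y_1\}\xrightarrow{f}\Sigma\{y_0',y_1'\}$ with $X=\{y_0,y_0'\}$, $Z=\{y_1,y_1'\}$ (read as $0$ when not an arc); the components of the first two maps to and from $X$, $Z$ are non-zero when the corresponding objects are non-zero. All subcategories are full and closed under direct sums and summands; $\mathrm{add}(\mathcal{Y})$ is the smallest such subcategory containing the set of arcs $\mathcal{Y}$. **t-structures.** A torsion pair in a triangulated category $\mathcal{T}$ is a pair $(\mathcal{X},\mathcal{Y})$ of subcategories closed under direct summands with $\mathrm{Hom}(X,Y)=0$ for $X\in\mathcal{X},Y\in\mathcal{Y}$ and such that every $T\in\mathcal{T}$ has a distinguished triangle $X\to T\to Y\to\Sigma X$ with $X\in\mathcal{X},Y\in\mathcal{Y}$.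 A t-structure is a torsion pair with $\Sigma\mathcal{X}\subseteq\mathcal{X}$; $\mathcal{X}$ is its aisle, $\mathcal{Y}=\mathcal{X}^\perp$ its coaisle. Its heart is the abelian subcategory $\mathcal{X}\cap\Sigma\mathcal{Y}$. It is left non-degenerate if $\bigcap_{k\in\mathbb{Z}}\Sigma^k\mathcal{X}=0$, right non-degenerate if $\bigcap_{k\in\mathbb{Z}}\Sigma^k\mathcal{Y}=0$, and non-degenerate if both hold. ''Module category'' means the category of finite-dimensional modules, and isomorphism of categories is understood as equivalence. **Decorated partitions.** A non-crossing partition $\mathcal{P}=\{B_m\mid m\in I\}$ of $[n]=\{1,\dots,n\}$ is a partition of $[n]$ into non-empty blocks such that whenever $i<k<j<l$ with $i,j\in B_{m_1}$, $k,l\in B_{m_2}$, then $m_1=m_2$. $i$ is a singleton of $\mathcal{P}$ if $\{i\}\in\mathcal{P}$; $i$ is an adjacency of $\mathcal{P}$ if $i$ and $i+1$ (cyclically modulo $n$) are in the same block. A $\overline{\mathcal{Z}}$-decoration of $\mathcal{P}$ is a tuple $\mathbf{x}=(x_1,\ldots,x_n)$ with $x_i\in[a_i,a_{i+1})$ if $i$ is a singleton, $x_i\in(a_i,a_{i+1}]$ if $i$ is an adjacency, and $x_i\in(a_i,a_{i+1})$ otherwise. Set $$\mathcal{X}(\mathcal{P},\mathbf{x})=\mathrm{add}\{\{y_0,y_1\}\text{ arc of }\mathcal{Z}\mid y_0,y_1\in\textstyle\bigcup_{i\in B}(a_i,x_i]\text{ for some }B\in\mathcal{P}\}.$$ The assignment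 $(\mathcal{P},\mathbf{x})\mapsto\mathcal{X}(\mathcal{P},\mathbf{x})$ is a bijection from $\overline{\mathcal{Z}}$-decorated non-crossing partitions of $[n]$ to aisles of t-structures in $\mathcal{C}(\mathcal{Z})$. *)

(* Defs.v *)
From HB Require Import structures.
From mathcomp Require Import all_boot all_order all_algebra.
From mathcomp Require Import all_classical all_reals all_analysis.

Set Implicit Arguments.
Unset Strict Implicit.
Unset Printing Implicit Defensive.

Import Order.TTheory GRing.Theory Num.Theory.
Import numFieldNormedType.Exports.

Local Open Scope classical_set_scope.
Local Open Scope ring_scope.

Record lincat (K : fieldType) := Lincat {
  ob :> Type;
  mor : ob -> ob -> lmodType K;
  idmor : forall X, mor X X;
  mcomp : forall X Y Z, mor Y Z -> mor X Y -> mor X Z;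
  compA : forall W X Y Z (h : mor Y Z) (g : mor X Y) (f : mor W X),
    mcomp h (mcomp g f) = mcomp (mcomp h g) f;
  comp1m : forall X Y (f : mor X Y), mcomp (idmor Y) f = f;
  compm1 : forall X Y (f : mor X Y), mcomp f (idmor X) = f;
  comp_linl : forall X Y Z (f : mor X Y), linear (fun g : mor Y Z => mcomp g f);
  comp_linr : forall X Y Z (g : mor Y Z), linear (fun f : mor X Y => mcomp g f)
}.

Arguments mor {K _} _ _.
Arguments idmor {K _} _.
Arguments mcomp {K _ X Y Z} _ _.

Notation "g \oc f" := (mcomp g f) (at level 40, left associativity).

Section LinearCategories.
Variable K : fieldType.
Implicit Types C D : lincat K.

Definition is_isom C (X Y : C) (f : mor X Y) : Prop :=
  exists g : mor Y X, g \oc f = idmor X /\ f \oc g = idmor Y.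

Definition isom C (X Y : C) : Prop := exists f : mor X Y, is_isom f.

(** Initial and terminal; maps to and from [X] always exist since hom sets
    contain [0]. *)
Definition is_zero C (X : C) : Prop :=
  forall Y : C, (forall f : mor X Y, f = 0) /\ (forall f : mor Y X, f = 0).

Definition is_biprod C (A B W : C) (i1 : mor A W) (i2 : mor B W)
    (p1 : mor W A) (p2 : mor W B) : Prop :=
  [/\ p1 \oc i1 = idmor A, p2 \oc i2 = idmor B, p1 \oc i2 = 0, p2 \oc i1 = 0
    & i1 \oc p1 + i2 \oc p2 = idmor W].

Definition is_sum C (A B W : C) : Prop :=
  exists i1 i2 p1 p2, @is_biprod C A B W i1 i2 p1 p2.

Definition additive_category C : Prop :=
  (exists X : C, is_zero X) /\ (forall A B : C, exists W, is_sum A B W).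

Definition indecomposable C (X : C) : Prop :=
  ~ is_zero X /\ forall A B : C, is_sum A B X -> is_zero A \/ is_zero B.

(** The endomorphism ring of [X] is local: it is non-zero and the sum of two
    non-units is a non-unit. *)
Definition local_end C (X : C) : Prop :=
  idmor X <> 0 /\
  forall f g : mor X X, ~ is_isom f -> ~ is_isom g -> ~ is_isom (f + g).

Inductive finite_sum_of C (P : C -> Prop) : C -> Prop :=
| finite_sum_nil X : is_zero X -> finite_sum_of P X
| finite_sum_cons A B W :
    P A -> finite_sum_of P B -> is_sum A B W -> finite_sum_of P W.

Definition krull_schmidt C : Prop :=
  forall X : C, finite_sum_of (@local_end C) X.

(** Full subcategories are given by their class of objects, a predicate because
    [set T] constrains [T] to a universe too small for modules. *)
Definition is_subcategory C (P : C -> Prop) : Prop :=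
  (forall X, is_zero X -> P X) /\
  (forall A B W : C, is_sum A B W -> (P W <-> P A /\ P B)).

Definition add_closure C (S : C -> Prop) : C -> Prop := fun X =>
  forall P : C -> Prop, is_subcategory P -> (forall A, S A -> P A) -> P X.

Definition full_subcategory C (P : C -> Prop) : lincat K :=
  @Lincat K {X : C | P X}
    (fun X Y => mor (sval X) (sval Y)) (fun X => idmor (sval X))
    (fun X Y Z g f => g \oc f)
    (fun W X Y Z => @compA K C (sval W) (sval X) (sval Y) (sval Z))
    (fun X Y => @comp1m K C (sval X) (sval Y))
    (fun X Y => @compm1 K C (sval X) (sval Y))
    (fun X Y Z => @comp_linl K C (sval X) (sval Y) (sval Z))
    (fun X Y Z => @comp_linr K C (sval X) (sval Y) (sval Z)).

Record functor C D := Functor {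
  fob :> C -> D;
  fmap : forall X Y : C, mor X Y -> mor (fob X) (fob Y);
  fmap_id : forall X : C, fmap (idmor X) = idmor (fob X);
  fmap_comp : forall (X Y Z : C) (g : mor Y Z) (f : mor X Y),
    fmap (g \oc f) = fmap g \oc fmap f
}.

Definition linear_functor C D (F : functor C D) : Prop :=
  forall X Y : C, linear (@fmap C D F X Y).

Definition id_functor C : functor C C :=
  @Functor C C id (fun _ _ f => f) (fun _ => erefl) (fun _ _ _ _ _ => erefl).

Lemma comp_functor_id C D E (G : functor D E) (F : functor C D) (X : C) :
  fmap G (fmap F (idmor X)) = idmor (G (F X)).
Proof. by rewrite !fmap_id. Qed.

Lemma comp_functor_comp C D E (G : functor D E) (F : functor C D)
    (X Y Z : C) (g : mor Y Z) (f : mor X Y) :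
  fmap G (fmap F (g \oc f)) = fmap G (fmap F g) \oc fmap G (fmap F f).
Proof. by rewrite !fmap_comp. Qed.

Definition comp_functor C D E (G : functor D E) (F : functor C D) :
    functor C E :=
  @Functor C E (fun X => G (F X)) (fun X Y f => fmap G (fmap F f))
    (comp_functor_id G F) (comp_functor_comp G F).

Definition nat_isomorphic C D (F G : functor C D) : Prop :=
  exists t : forall X : C, mor (F X) (G X),
    (forall X, is_isom (t X)) /\
    (forall (X Y : C) (f : mor X Y), t Y \oc fmap F f = fmap G f \oc t X).

Definition quasi_inverse C D (F : functor C D) (G : functor D C) : Prop :=
  nat_isomorphic (comp_functor G F) (id_functor C) /\
  nat_isomorphic (comp_functor F G) (id_functor D).

Definition equivalent C D : Prop :=
  exists (F : functor C D) (G : functor D C), quasi_inverse F G.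

Definition linearly_equivalent C D : Prop :=
  exists (F : functor C D) (G : functor D C),
    linear_functor F /\ quasi_inverse F G.

End LinearCategories.

(** A [K]-algebra is a ring [A] with a structure map [iota : K -> A]; a
    finite-dimensional [A]-module is a finite-dimensional [K]-vector space on
    which [A] acts by [K]-linear maps, [iota c] acting as the scalar [c]. *)

Section Modules.
Variables (K : fieldType) (A : pzRingType) (iota : K -> A).

Record fdmod := FdMod {
  fdmod_space :> vectType K;
  fdmod_act : A -> 'End(fdmod_space);
  fdmod_actD : forall a b v,
    fdmod_act (a + b) v = fdmod_act a v + fdmod_act b v;
  fdmod_actM : forall a b v, fdmod_act (a * b) v = fdmod_act a (fdmod_act b v);
  fdmod_act1 : forall v, fdmod_act 1 v = v;
  fdmod_actK : forall c v, fdmod_act (iota c) v = c *: v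
}.

Arguments fdmod_act : clear implicits.

Definition equivariant (U V : fdmod) : {pred 'Hom(U, V)} :=
  fun f => `[< forall a v, f (fdmod_act U a v) = fdmod_act V a (f v) >].

Arguments equivariant : clear implicits.

Lemma equivariantP (U V : fdmod) (f : 'Hom(U, V)) :
  reflect (forall a v, f (fdmod_act U a v) = fdmod_act V a (f v))
          (f \in equivariant U V).
Proof. exact: asboolP. Qed.

Lemma equivariant_submod_closed (U V : fdmod) :
  submod_closed (equivariant U V).
Proof.
split=> [|c f g /equivariantP fA /equivariantP gA]; apply/equivariantP => a v.
  by rewrite !lfunE /= linear0.
by rewrite !lfunE /= !lfunE /= fA gA linearP.
Qed.

HB.instance Definition _ (U V : fdmod) :=
  GRing.isSubmodClosed.Build K 'Hom(U, V) (equivariant U V)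
    (equivariant_submod_closed U V).

Record modhom (U V : fdmod) := ModHom {
  modhom_val :> 'Hom(U, V);
  modhomP : modhom_val \in equivariant U V
}.

HB.instance Definition _ (U V : fdmod) := [isSub for @modhom_val U V].
HB.instance Definition _ (U V : fdmod) := [Choice of modhom U V by <:].
HB.instance Definition _ (U V : fdmod) :=
  [SubChoice_isSubLmodule of modhom U V by <:].

Lemma id_equivariant (U : fdmod) : \1%VF \in equivariant U U.
Proof. by apply/equivariantP => a v; rewrite !lfunE. Qed.

Lemma comp_equivariant (U V W : fdmod) (g : modhom V W) (f : modhom U V) :
  (modhom_val g \o modhom_val f)%VF \in equivariant U W.
Proof.
apply/equivariantP => a v; rewrite !lfunE /=.
by rewrite (equivariantP _ (modhomP f)) (equivariantP _ (modhomP g)).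
Qed.

Definition modhom_id (U : fdmod) : modhom U U := ModHom (id_equivariant U).

Definition modhom_comp (U V W : fdmod) (g : modhom V W) (f : modhom U V) :
  modhom U W := ModHom (comp_equivariant g f).

Lemma modhom_compA (T U V W : fdmod) (h : modhom V W) (g : modhom U V)
    (f : modhom T U) :
  modhom_comp h (modhom_comp g f) = modhom_comp (modhom_comp h g) f.
Proof. by apply/val_inj; rewrite /= comp_lfunA. Qed.

Lemma modhom_comp1m (U V : fdmod) (f : modhom U V) :
  modhom_comp (modhom_id V) f = f.
Proof. by apply/val_inj; rewrite /= comp_lfun1l. Qed.

Lemma modhom_compm1 (U V : fdmod) (f : modhom U V) :
  modhom_comp f (modhom_id U) = f.
Proof. by apply/val_inj; rewrite /= comp_lfun1r. Qed.

Lemma modhom_comp_linl (U V W : fdmod) (f : modhom U V) :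
  linear (fun g : modhom V W => modhom_comp g f).
Proof.
by move=> c g h; apply/val_inj; rewrite /= comp_lfunDl comp_lfunZl.
Qed.

Lemma modhom_comp_linr (U V W : fdmod) (g : modhom V W) :
  linear (fun f : modhom U V => modhom_comp g f).
Proof.
by move=> c f h; apply/val_inj; rewrite /= comp_lfunDr comp_lfunZr.
Qed.

Definition module_category : lincat K :=
  @Lincat K fdmod (fun U V => modhom U V) modhom_id modhom_comp
    modhom_compA modhom_comp1m modhom_compm1 modhom_comp_linl modhom_comp_linr.

End Modules.

Definition power_module_category (K : fieldType) (n : nat) : lincat K :=
  @module_category K {ffun 'I_n -> K} (fun c => [ffun=> c]).

Record tricat (K : fieldType) := Tricat {
  tcat :> lincat K;
  tcat_additive : additive_category tcat;
  susp : functor tcat tcat;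
  desusp : functor tcat tcat;
  susp_linear : linear_functor susp;
  susp_desusp : quasi_inverse susp desusp;
  triangle : forall X Y Z : tcat,
    mor X Y -> mor Y Z -> mor Z (susp X) -> Prop;
  dist_isom : forall (X Y Z X' Y' Z' : tcat)
      (f : mor X Y) (g : mor Y Z) (h : mor Z (susp X))
      (f' : mor X' Y') (g' : mor Y' Z') (h' : mor Z' (susp X'))
      (u : mor X X') (v : mor Y Y') (w : mor Z Z'),
    is_isom u -> is_isom v -> is_isom w ->
    v \oc f = f' \oc u -> w \oc g = g' \oc v -> fmap susp u \oc h = h' \oc w ->
    triangle f g h -> triangle f' g' h';
  dist_id : forall X Z : tcat, is_zero Z ->
    triangle (idmor X) (0 : mor X Z) (0 : mor Z (susp X));
  dist_cone : forall (X Y : tcat) (f : mor X Y),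
    exists (Z : tcat) (g : mor Y Z) (h : mor Z (susp X)), triangle f g h;
  dist_rot : forall (X Y Z : tcat)
      (f : mor X Y) (g : mor Y Z) (h : mor Z (susp X)),
    triangle f g h <-> triangle g h (- fmap susp f);
  dist_morph : forall (X Y Z X' Y' Z' : tcat)
      (f : mor X Y) (g : mor Y Z) (h : mor Z (susp X))
      (f' : mor X' Y') (g' : mor Y' Z') (h' : mor Z' (susp X'))
      (u : mor X X') (v : mor Y Y'),
    triangle f g h -> triangle f' g' h' -> v \oc f = f' \oc u ->
    exists w : mor Z Z',
      w \oc g = g' \oc v /\ fmap susp u \oc h = h' \oc w;
  dist_octahedron : forall (X Y Z X' Y' Z' : tcat)
      (f : mor X Y) (f1 : mor Y Z') (f2 : mor Z' (susp X))
      (g : mor Y Z) (g1 : mor Z X') (g2 : mor X' (susp Y))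
      (h1 : mor Z Y') (h2 : mor Y' (susp X)),
    triangle f f1 f2 -> triangle g g1 g2 -> triangle (g \oc f) h1 h2 ->
    exists (u : mor Z' Y') (v : mor Y' X'),
      [/\ triangle u v (fmap susp f1 \oc g2),
          u \oc f1 = h1 \oc g, h2 \oc u = f2,
          v \oc h1 = g1 & g2 \oc v = fmap susp f \oc h2]
}.

Section Triangulated.
Variables (K : fieldType) (T : tricat K).
Notation S := (susp T).

(** The pairing [b] encodes a bijection, natural in both variables, from
    [mor X Y] to the dual of [mor Y (S (S X))]. *)
Definition calabi_yau2 : Prop :=
  exists b : forall X Y : T, mor X Y -> mor Y (S (S X)) -> K,
  [/\ forall (X Y : T) (g : mor Y (S (S X))),
         scalar (fun f : mor X Y => b X Y f g),
      forall (X Y : T) (f : mor X Y), scalar (b X Y f),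
      forall (X Y : T) (phi : mor Y (S (S X)) -> K), scalar phi ->
        exists! f : mor X Y, forall g, b X Y f g = phi g,
      forall (X Y Y' : T) (f : mor X Y) (u : mor Y Y') (g : mor Y' (S (S X))),
        b X Y' (u \oc f) g = b X Y f (g \oc u)
    & forall (X X' Y : T) (u : mor X' X) (f : mor X Y) (g : mor Y (S (S X'))),
        b X' Y (f \oc u) g = b X Y f (fmap S (fmap S u) \oc g)].

Definition suspz (k : int) (X : T) : T :=
  match k with
  | Posz m => iter m (fob S) X
  | Negz m => iter m.+1 (fob (desusp T)) X
  end.

Definition shift_sub (k : int) (P : T -> Prop) : T -> Prop :=
  fun X => exists2 A, P A & isom X (suspz k A).

Definition torsion_pair (X Y : T -> Prop) : Prop :=
  [/\ is_subcategory X, is_subcategory Y,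
      forall A B, X A -> Y B -> forall f : mor A B, f = 0
    & forall W : T, exists A B (f : mor A W) (g : mor W B) (h : mor B (S A)),
        [/\ X A, Y B & triangle f g h]].

Definition t_structure (X Y : T -> Prop) : Prop :=
  torsion_pair X Y /\ forall A, shift_sub 1 X A -> X A.

Definition heart (X Y : T -> Prop) : lincat K :=
  full_subcategory (fun A => X A /\ shift_sub 1 Y A).

Definition t_left_nondegenerate (X : T -> Prop) : Prop :=
  forall A, (forall k : int, shift_sub k X A) <-> is_zero A.

Definition t_right_nondegenerate (Y : T -> Prop) : Prop :=
  forall A, (forall k : int, shift_sub k Y A) <-> is_zero A.

Definition t_nondegenerate (X Y : T -> Prop) : Prop :=
  t_left_nondegenerate X /\ t_right_nondegenerate Y.

End Triangulated.

Section Circle.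
Variable R : realType.
Notation point := (R * R)%type.
Implicit Types (x y z : point) (Z : set point).

Definition circle : set point := [set p | p.1 ^+ 2 + p.2 ^+ 2 = 1].

Definition circle_at (t : R) : point := (cos t, sin t).

(** [x < y < z]: turning anti-clockwise once, starting at [x], one meets [y]
    and then [z]. *)
Definition cyc x y z : Prop :=
  exists r s t : R,
    [/\ r < s, s < t, t < r + 2 * pi
      & [/\ x = circle_at r, y = circle_at s & z = circle_at t]].

Definition cyc4 x1 x2 x3 x4 : Prop :=
  [/\ cyc x1 x2 x3, cyc x2 x3 x4, cyc x3 x4 x1 & cyc x4 x1 x2].

Definition limit_points Z : set point := closure Z `\` Z.

Definition admissible Z : Prop :=
  [/\ Z `<=` circle, Z `<=` isolated Z, infinite_set Z,
      finite_set (limit_points Z)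
    & forall p, limit_points Z p -> forall q, circle q -> q <> p ->
        (exists2 z, Z z & cyc p z q) /\ (exists2 z, Z z & cyc q z p)].

(** All triples are required: imposing the order on consecutive triples only
    would allow [a] to wind around the circle several times. *)
Definition limit_point_enumeration Z (n : nat) (a : 'I_n -> point) : Prop :=
  [/\ range a = limit_points Z, injective a
    & forall i j k : 'I_n, (i < j < k)%N -> cyc (a i) (a j) (a k)].

Definition arc_oo Z x y : set point := [set c | closure Z c /\ cyc x c y].

Definition arc_co Z x y : set point :=
  [set c | x <> y /\ (c = x \/ arc_oo Z x y c)].

Definition arc_oc Z x y : set point :=
  [set c | x <> y /\ (c = y \/ arc_oo Z x y c)].

Definition arc_cc Z x y : set point :=
  [set c | [\/ c = x, c = y | arc_oo Z x y c]].

Definition zsucc Z z : point :=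
  xget z [set w | [/\ Z w, w <> z & forall u, Z u -> ~ cyc z u w]].

Definition zpred Z z : point :=
  xget z [set w | [/\ Z w, w <> z & forall u, Z u -> ~ cyc w u z]].

Definition is_arc Z (A : set point) : Prop :=
  exists z0 z1, [/\ A = [set z0; z1], Z z0, Z z1
    & [/\ z1 <> zpred Z z0, z1 <> z0 & z1 <> zsucc Z z0]].

Definition cross (A B : set point) : Prop :=
  exists y0 y1 y0' y1', [/\ A = [set y0; y1], B = [set y0'; y1']
    & cyc4 y0 y0' y1 y1' \/ cyc4 y0 y1' y1 y0'].

End Circle.

(** [arc_ob A] is the indecomposable object attached to the arc [A]; it is a
    zero object when [A] is not an arc. *)
Record cluster_category (K : fieldType) (R : realType) (Z : set (R * R)) :=
    ClusterCategory {
  cluster_tricat :> tricat K;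
  cluster_krull_schmidt : krull_schmidt cluster_tricat;
  cluster_calabi_yau : calabi_yau2 cluster_tricat;
  arc_ob : set (R * R) -> cluster_tricat;
  arc_ob_zero : forall A, ~ is_arc Z A -> is_zero (arc_ob A);
  arc_ob_indecomposable : forall A, is_arc Z A -> indecomposable (arc_ob A);
  arc_ob_surj : forall X : cluster_tricat, indecomposable X ->
    exists2 A, is_arc Z A & isom X (arc_ob A);
  arc_ob_inj : forall A B, is_arc Z A -> is_arc Z B ->
    isom (arc_ob A) (arc_ob B) -> A = B;
  arc_ob_susp : forall A, is_arc Z A ->
    isom (susp cluster_tricat (arc_ob A)) (arc_ob (zpred Z @` A));
  arc_hom_cross : forall A B, is_arc Z A -> is_arc Z B -> cross A B ->
    exists2 phi : mor (arc_ob A) (susp cluster_tricat (arc_ob B)) -> K,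
      scalar phi & bijective phi;
  arc_hom_ncross : forall A B, is_arc Z A -> is_arc Z B -> ~ cross A B ->
    forall f : mor (arc_ob A) (susp cluster_tricat (arc_ob B)), f = 0;
  arc_factor : forall y0 y1 y0' y1',
    is_arc Z [set y0; y1] -> is_arc Z [set y0'; y1'] ->
    cyc4 y0 (zsucc Z y0') y1 (zsucc Z y1') ->
    forall f : mor (arc_ob [set y0; y1]) (arc_ob [set y0'; y1']), f <> 0 ->
    forall S : cluster_tricat, indecomposable S ->
    (exists (g : mor S (arc_ob [set y0'; y1']))
            (h : mor (arc_ob [set y0; y1]) S), f = g \oc h) <->
    (exists s0 s1, [/\ is_arc Z [set s0; s1], isom S (arc_ob [set s0; s1]),
       arc_cc Z y0 y0' s0 & arc_cc Z y1 y1' s1]);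
  arc_triangle : forall y0 y1 y0' y1',
    is_arc Z [set y0; y1] -> is_arc Z [set y0'; y1'] -> cyc4 y0 y0' y1 y1' ->
    forall f : mor (arc_ob [set y0; y1])
                   (susp cluster_tricat (arc_ob [set y0'; y1'])), f <> 0 ->
    exists W (iX : mor (arc_ob [set y0; y0']) W)
             (iZ : mor (arc_ob [set y1; y1']) W)
             (pX : mor W (arc_ob [set y0; y0']))
             (pZ : mor W (arc_ob [set y1; y1']))
             (u : mor (arc_ob [set y0'; y1']) W)
             (v : mor W (arc_ob [set y0; y1])),
      [/\ is_biprod iX iZ pX pZ, triangle u v f,
          is_arc Z [set y0; y0'] -> pX \oc u <> 0 /\ v \oc iX <> 0
        & is_arc Z [set y1; y1'] -> pZ \oc u <> 0 /\ v \oc iZ <> 0]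
}.

Definition noncrossing (n : nat) (P : {set {set 'I_n}}) : Prop :=
  finset.partition P [set: 'I_n]%SET /\
  forall (B1 B2 : {set 'I_n}) (i k j l : 'I_n),
    B1 \in P -> B2 \in P -> (i < k)%N -> (k < j)%N -> (j < l)%N ->
    i \in B1 -> j \in B1 -> k \in B2 -> l \in B2 -> B1 = B2.

Definition singleton (n : nat) (P : {set {set 'I_n}}) (i : 'I_n) : Prop :=
  [set i]%SET \in P.

Definition adjacency (n : nat) (P : {set {set 'I_n}}) (i : 'I_n) : Prop :=
  exists2 B : {set 'I_n}, B \in P & i \in B /\ ordS i \in B.

Section Decorations.
Variables (R : realType) (Z : set (R * R)) (n : nat) (a : 'I_n -> R * R).

Definition decoration (P : {set {set 'I_n}}) (x : 'I_n -> R * R) : Prop :=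
  forall i,
    [/\ singleton P i -> arc_co Z (a i) (a (ordS i)) (x i),
        adjacency P i -> arc_oc Z (a i) (a (ordS i)) (x i)
      & ~ singleton P i -> ~ adjacency P i ->
        arc_oo Z (a i) (a (ordS i)) (x i)].

Definition aisle_arcs (P : {set {set 'I_n}}) (x : 'I_n -> R * R) :
    set (set (R * R)) :=
  [set A | is_arc Z A /\ exists2 B : {set 'I_n}, B \in P &
     A `<=` [set y | exists2 i, i \in B & arc_oc Z (a i) (x i) y]].

Definition aisle (K : fieldType) (C : cluster_category K Z)
    (P : {set {set 'I_n}}) (x : 'I_n -> R * R) : C -> Prop :=
  add_closure (fun X => exists2 A, aisle_arcs P x A & X = arc_ob C A).

End Decorations.

Arguments aisle {R Z n} a {K} C P x _.

(* Main.v *)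
(** Write z+ and z- for the neighbours of z. Objects of the cluster category are
    controlled by their indecomposable summands (Krull-Schmidt), and maps
    between arcs by crossings: Hom(A, B) is non-zero exactly when A crosses the
    desuspension B+ = [zsucc Z @` B] of B. Hence X contains the arcs with both
    endpoints in the union of the intervals (a_i, x_i] over one block, and
    Y = X^perp the arcs B such that B+ crosses none of those.

    If x_i = a_(i+1), every arc {z, z++} in the i-th gap stays in X under all
    shifts; if x_i lies in Z, then iterating the successor pushes any endpoint
    in the i-th gap beyond x_i, so no arc survives. Dually, if x_i = a_i, then
    no X-arc has an endpoint in the i-th gap, so {z, z++} and its shifts lie in
    Y; otherwise a sufficiently large suspension {y, y'} of any arc is crossed
    by the X-arc {y-, y+}.

    An arc A of X lies in the heart exactly when A++ crosses no X-arc. Now A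
    itself crosses A++ unless A = {y, y++}, and then the arc {y, y+++} crosses
    A++ and lies in X unless y++ = x_i. So the indecomposables of the heart are
    the arcs {x_i--, x_i} with x_i in Z. They are pairwise orthogonal with
    endomorphism ring K, so the heart is the category of modules over K^m, where
    m is the number of i with x_i in Z; an equivalence with the modules over K^n
    forces m = n, by counting objects all of whose endomorphisms are invertible
    or zero. *)
From HB Require Import structures.
Require Import Defs.
From mathcomp Require Import all_boot all_order all_algebra.
From mathcomp Require Import all_classical all_reals all_analysis.
From mathcomp Require Import lra.

Set Implicit Arguments.
Unset Strict Implicit.
Unset Printing Implicit Defensive.

Import Order.TTheory GRing.Theory Num.Theory.
Import numFieldNormedType.Exports.

(** * Linear categories *)

Section LinearCategoryTheory.
Local Open Scope ring_scope.
Variable K : fieldType.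
Implicit Types C D : lincat K.

Lemma mcompA C (W X Y Z : C) (h : mor Y Z) (g : mor X Y) (f : mor W X) :
  h \oc (g \oc f) = h \oc g \oc f.
Proof. exact: Defs.compA. Qed.

Lemma compDl C (X Y Z : C) (g h : mor Y Z) (f : mor X Y) :
  (g + h) \oc f = g \oc f + h \oc f.
Proof. by have := comp_linl f 1 g h; rewrite !scale1r. Qed.

Lemma comp0l C (X Y Z : C) (f : mor X Y) : (0 : mor Y Z) \oc f = 0.
Proof. by apply: (addrI (0 \oc f)); rewrite -compDl !addr0. Qed.

Lemma compZl C (X Y Z : C) c (g : mor Y Z) (f : mor X Y) :
  (c *: g) \oc f = c *: (g \oc f).
Proof. by have := comp_linl f c g 0; rewrite !addr0 comp0l addr0. Qed.

Lemma compNl C (X Y Z : C) (g : mor Y Z) (f : mor X Y) :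
  (- g) \oc f = - (g \oc f).
Proof. by rewrite -!scaleN1r compZl. Qed.

Lemma compBl C (X Y Z : C) (g h : mor Y Z) (f : mor X Y) :
  (g - h) \oc f = g \oc f - h \oc f.
Proof. by rewrite compDl compNl. Qed.

Lemma compDr C (X Y Z : C) (g : mor Y Z) (f h : mor X Y) :
  g \oc (f + h) = g \oc f + g \oc h.
Proof. by have := comp_linr g 1 f h; rewrite !scale1r. Qed.

Lemma comp0r C (X Y Z : C) (g : mor Y Z) : g \oc (0 : mor X Y) = 0.
Proof. by apply: (addrI (g \oc 0)); rewrite -compDr !addr0. Qed.

Lemma compZr C (X Y Z : C) c (g : mor Y Z) (f : mor X Y) :
  g \oc (c *: f) = c *: (g \oc f).
Proof. by have := comp_linr g c f 0; rewrite !addr0 comp0r addr0. Qed.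

Lemma compNr C (X Y Z : C) (g : mor Y Z) (f : mor X Y) :
  g \oc (- f) = - (g \oc f).
Proof. by rewrite -!scaleN1r compZr. Qed.

Lemma compBr C (X Y Z : C) (g : mor Y Z) (f h : mor X Y) :
  g \oc (f - h) = g \oc f - g \oc h.
Proof. by rewrite compDr compNr. Qed.

Lemma comp_suml C (X Y Z : C) (f : mor X Y) I (r : seq I) (P : pred I)
    (F : I -> mor Y Z) :
  (\sum_(i <- r | P i) F i) \oc f = \sum_(i <- r | P i) (F i \oc f).
Proof.
exact: (big_morph (fun g : mor Y Z => g \oc f) (fun g h => compDl g h f)
  (comp0l _ f)).
Qed.

Lemma comp_sumr C (X Y Z : C) (g : mor Y Z) I (r : seq I) (P : pred I)
    (F : I -> mor X Y) :
  g \oc (\sum_(i <- r | P i) F i) = \sum_(i <- r | P i) (g \oc F i).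
Proof.
exact: (big_morph (fun f : mor X Y => g \oc f) (compDr g) (comp0r _ g)).
Qed.

(** * Isomorphisms, zero objects and direct sums *)

Lemma isom_refl C (X : C) : isom X X.
Proof. by exists (idmor X), (idmor X); rewrite !comp1m. Qed.

Lemma isom_sym C (X Y : C) : isom X Y -> isom Y X.
Proof. by move=> [f [g [gf fg]]]; exists g, f. Qed.

Lemma is_isom_comp C (X Y Z : C) (g : mor Y Z) (f : mor X Y) :
  is_isom g -> is_isom f -> is_isom (g \oc f).
Proof.
move=> [g' [g'g gg']] [f' [f'f ff']]; exists (f' \oc g'); split.
- by rewrite -mcompA [g' \oc _]mcompA g'g comp1m.
- by rewrite -mcompA [f \oc _]mcompA ff' comp1m.
Qed.

Lemma isom_trans C (X Y Z : C) : isom X Y -> isom Y Z -> isom X Z.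
Proof. by move=> [f fi] [g gi]; exists (g \oc f); exact: is_isom_comp. Qed.

Lemma is_zeroP C (X : C) : is_zero X <-> idmor X = 0.
Proof.
split=> [X0|X0 Y]; first by case: (X0 X).
split=> f; first by rewrite -(compm1 f) X0 comp0r.
by rewrite -(comp1m f) X0 comp0l.
Qed.

Lemma is_sum_zero C (A B W : C) : is_zero B -> isom A W -> is_sum A B W.
Proof.
move=> B0 [f [g [gf fg]]]; exists f, 0, g, 0; split=> //.
- by rewrite comp0l (is_zeroP B).1.
- by rewrite comp0r.
- by rewrite comp0l.
- by rewrite comp0r addr0.
Qed.

Lemma is_sum_zeror C (A B W : C) : is_sum A B W -> is_zero B -> isom A W.
Proof.
move=> [i1 [i2 [p1 [p2 [pi1 _ _ _ e]]]]] B0.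
exists i1, p1; split=> //; rewrite -e (proj1 (B0 _) i2).
by rewrite comp0l addr0.
Qed.

Lemma is_sumC C (A B W : C) : is_sum A B W -> is_sum B A W.
Proof.
move=> [i1 [i2 [p1 [p2 [pi1 pi2 e12 e21 e]]]]].
by exists i2, i1, p2, p1; split=> //; rewrite addrC.
Qed.

Lemma sub_isom C (P : C -> Prop) : (exists Z : C, is_zero Z) ->
  is_subcategory P -> forall A B, isom A B -> P A -> P B.
Proof.
move=> [Z Z0] [P0 PS] A B AB PA.
by apply/(PS A Z B (is_sum_zero Z0 AB)); split=> //; exact: P0.
Qed.

(** No complement is asked for, so retracts compose freely and no idempotent has to be split. *)
Definition retract C (A W : C) : Prop :=
  exists (i : mor A W) (p : mor W A), p \oc i = idmor A.

Lemma retract_trans C (A B W : C) : retract A B -> retract B W -> retract A W.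
Proof.
move=> [i [p pi]] [j [q qj]]; exists (j \oc i), (p \oc q).
by rewrite -mcompA [q \oc _]mcompA qj comp1m.
Qed.

Lemma is_sum_retract C (A B W : C) : is_sum A B W -> retract A W.
Proof. by move=> [i1 [i2 [p1 [p2 [pi1 _ _ _ _]]]]]; exists i1, p1. Qed.

Lemma retract_zero C (A W : C) : retract A W -> is_zero W -> is_zero A.
Proof.
move=> [i [p pi]] W0; apply/is_zeroP.
by rewrite -pi (proj2 (W0 _) i) comp0r.
Qed.

Lemma is_isom_idem C (X : C) (e : mor X X) :
  is_isom e -> e \oc e = e -> e = idmor X.
Proof.
by move=> [g [ge eg]] ee; rewrite -(comp1m e) -ge -mcompA ee.
Qed.

Lemma is_isom_idmor C (X : C) : is_isom (idmor X).
Proof. by exists (idmor X); rewrite comp1m. Qed.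

Lemma local_end_split C (X : C) (f g : mor X X) :
  local_end X -> f + g = idmor X -> is_isom f \/ is_isom g.
Proof.
move=> [_ Xloc] fg; apply: contrapT => /not_orP[nf ng].
by apply: (Xloc f g nf ng); rewrite fg; exact: is_isom_idmor.
Qed.

(** The idempotent [i \oc p] and its complement add up to the identity, so one of them is invertible
    and hence the identity. If it is the complement, then [i \oc p] vanishes and the identity of [A]
    with it. *)
Lemma local_retract C (A B : C) :
  idmor A <> 0 -> local_end B -> retract A B -> isom A B.
Proof.
move=> A0 Bloc [i [p pi]].
have ee : (i \oc p) \oc (i \oc p) = i \oc p.
  by rewrite -mcompA [p \oc _]mcompA pi comp1m.
have [] := @local_end_split _ _ (i \oc p) (idmor B - i \oc p) Bloc.
- by rewrite addrC subrK.
- by move=> /is_isom_idem/(_ ee) e1; exists i, p.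
- move=> /is_isom_idem; rewrite compBl comp1m compBr compm1 ee subrr subr0.
  move=> /(_ erefl) e1; case: A0.
  have ip0 : i \oc p = 0.
    by rewrite -[i \oc p](subKr (idmor B)) e1 subrr.
  by rewrite -(comp1m (idmor A)) -{1}pi -pi -mcompA [i \oc _]mcompA ip0
             comp0l comp0r.
Qed.

Lemma isom_local_end C (X Y : C) : isom X Y -> local_end X -> local_end Y.
Proof.
move=> [f [g [gf fg]]] [X0 Xloc]; split=> [Y0|u v nu nv].
  by apply: X0; rewrite -gf -(comp1m f) Y0 comp0l comp0r.
have conj (w : mor Y Y) : is_isom (g \oc w \oc f) <-> is_isom w.
  split=> [wi|wi].
  - have -> : w = f \oc (g \oc w \oc f) \oc g.
      by rewrite !mcompA fg comp1m -mcompA fg compm1.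
    apply: is_isom_comp; last by exists f.
    by apply: is_isom_comp => //; exists g.
  - apply: is_isom_comp; last by exists g.
    by apply: is_isom_comp => //; exists f.
move=> /conj; rewrite compDr compDl.
by apply: Xloc => /conj.
Qed.

(** The identity of [A] is the sum of its parts through [A1] and [A2]. Locality makes one part
    invertible, and composing with the inverse gives a retraction. *)
Lemma local_retract_sum C (A A1 A2 W : C) : local_end A -> is_sum A1 A2 W ->
  retract A W -> retract A A1 \/ retract A A2.
Proof.
move=> Aloc [i1 [i2 [p1 [p2 [_ _ _ _ e]]]]] [i [p pi]].
have [] := @local_end_split _ A (p \oc i1 \oc (p1 \oc i))
  (p \oc i2 \oc (p2 \oc i)) Aloc.
- rewrite -pi -{3}[p]compm1 -e compDr compDl.
  by rewrite !mcompA.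
- move=> [h [hu _]]; left; exists (p1 \oc i), (h \oc (p \oc i1)).
  by rewrite -mcompA.
- move=> [h [hu _]]; right; exists (p2 \oc i), (h \oc (p \oc i2)).
  by rewrite -mcompA.
Qed.

Lemma indecomposable_local C (X : C) :
  krull_schmidt C -> indecomposable X -> local_end X.
Proof.
move=> KS [X0 Xind]; case: (KS X) X0 Xind => [Y Y0 /(_ Y0)//|A B W Aloc _ ABW].
move=> _ /(_ A B ABW)[/is_zeroP A0|B0]; first by case: Aloc.
exact: isom_local_end (is_sum_zeror ABW B0) Aloc.
Qed.

Lemma local_indecomposable C (X : C) : local_end X -> indecomposable X.
Proof.
move=> Xloc; split=> [/is_zeroP X0|A B AB]; first by case: Xloc.
have [A0|A0] := pselect (idmor A = 0); first by left; exact/is_zeroP.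
right; move: AB => [i1 [i2 [p1 [p2 [pi1 pi2 e12 e21 e]]]]].
have [] := @local_end_split _ _ (i1 \oc p1) (i2 \oc p2) Xloc e.
- move=> /is_isom_idem; rewrite -mcompA [p1 \oc _]mcompA pi1 comp1m.
  move=> /(_ erefl) e1; apply/is_zeroP.
  by rewrite -pi2 -(compm1 p2) -e1 mcompA e21 !comp0l.
- move=> /is_isom_idem; rewrite -mcompA [p2 \oc _]mcompA pi2 comp1m.
  move=> /(_ erefl) e1; case: A0.
  by rewrite -pi1 -(compm1 p1) -e1 mcompA e12 !comp0l.
Qed.

Lemma nonzero_local_summand C (X : C) : krull_schmidt C -> ~ is_zero X ->
  exists A B, local_end A /\ is_sum A B X.
Proof.
move=> KS; case: (KS X) => [Y ? //|A B W Aloc _ ABW _].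
by exists A, B.
Qed.

Lemma finite_sum_of_sub C (P Q : C -> Prop) (X : C) : is_subcategory Q ->
  finite_sum_of P X -> Q X -> finite_sum_of (fun A => P A /\ Q A) X.
Proof.
move=> [_ QS]; elim=> [Y Y0 _|A B W PA _ IH ABW /(QS _ _ _ ABW)[QA QB]].
  exact: finite_sum_nil.
exact: (finite_sum_cons (conj PA QA) (IH QB) ABW).
Qed.

(** The closure is contained in every subcategory that contains [S]; it is tested against the class
    [Q] of objects all of whose local retracts are isomorphic to generators. *)
Lemma add_closure_local C (S : C -> Prop) (A : C) :
  (forall G, S G -> local_end G) -> local_end A -> add_closure S A ->
  exists2 G, S G & isom A G.
Proof.
move=> Sloc Aloc SA.
pose Q W := forall B : C, local_end B -> retract B W ->
  exists2 G, S G & isom B G.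
apply: (SA Q) => //; last by exists (idmor A), (idmor A); rewrite comp1m.
- split=> [X X0 B [B0 _] /retract_zero/(_ X0)/is_zeroP//|A1 A2 W AW].
  split=> [QW|[Q1 Q2] B Bloc BW].
  + split=> B Bloc BA; apply: QW => //; apply: retract_trans BA _.
      exact: is_sum_retract AW.
    exact: is_sum_retract (is_sumC AW).
  + by have [/Q1|/Q2] := local_retract_sum Bloc AW BW; exact.
- move=> G SG B [B0 _] BG; exists G => //.
  exact: local_retract (Sloc _ SG) BG.
Qed.

Lemma add_closure_gen C (S : C -> Prop) A : S A -> add_closure S A.
Proof. by move=> SA P _; exact. Qed.

Lemma left_orth_sub C (T : C -> Prop) :
  is_subcategory (fun A => forall B, T B -> forall f : mor A B, f = 0).
Proof.
split=> [X X0 B _ f|A B W [i1 [i2 [p1 [p2 [pi1 pi2 _ _ e]]]]]].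
  by case: (X0 B).
split=> [W0|[A0 B0] Y TY f].
  split=> Y TY f.
  - by rewrite -(compm1 f) -pi1 mcompA (W0 _ TY (f \oc p1)) comp0l.
  - by rewrite -(compm1 f) -pi2 mcompA (W0 _ TY (f \oc p2)) comp0l.
rewrite -(compm1 f) -e compDr !mcompA (A0 _ TY (f \oc i1)).
by rewrite (B0 _ TY (f \oc i2)) !comp0l addr0.
Qed.

Lemma right_orth_sub C (T : C -> Prop) :
  is_subcategory (fun A => forall B, T B -> forall f : mor B A, f = 0).
Proof.
split=> [X X0 B _ f|A B W [i1 [i2 [p1 [p2 [pi1 pi2 _ _ e]]]]]].
  by case: (X0 B).
split=> [W0|[A0 B0] Y TY f].
  split=> Y TY f.
  - by rewrite -(comp1m f) -pi1 -mcompA (W0 _ TY (i1 \oc f)) comp0r.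
  - by rewrite -(comp1m f) -pi2 -mcompA (W0 _ TY (i2 \oc f)) comp0r.
rewrite -(comp1m f) -e compDl -!mcompA (A0 _ TY (p1 \oc f)).
by rewrite (B0 _ TY (p2 \oc f)) !comp0r addr0.
Qed.

Lemma sub_and C (P Q : C -> Prop) : is_subcategory P -> is_subcategory Q ->
  is_subcategory (fun A => P A /\ Q A).
Proof.
move=> [P0 PS] [Q0 QS]; split=> [X X0|A B W ABW].
  by split; [exact: P0|exact: Q0].
by rewrite (PS _ _ _ ABW) (QS _ _ _ ABW); tauto.
Qed.

Lemma isom_hom0r C (X Y Y' : C) : isom Y Y' ->
  (forall f : mor X Y, f = 0) -> forall f : mor X Y', f = 0.
Proof.
move=> [u [v [_ uv]]] Y0 f.
by rewrite -(comp1m f) -uv -mcompA (Y0 (v \oc f)) comp0r.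
Qed.

(** The functional lives on maps into an isomorphic copy [Y'] because [arc_hom_cross] provides it
    only for suspended targets. *)
Lemma one_dim_hom C (X Y Y' : C) (phi : mor X Y' -> K) (f g : mor X Y) :
  isom Y Y' -> scalar phi -> injective phi -> g <> 0 -> exists c, f = c *: g.
Proof.
move=> [u [v [vu _]]] philin phi_inj g0.
have phi0 : phi 0 = 0.
  by have := philin (-1) 0 0; rewrite scaler0 add0r mulN1r addNr.
have phiZ c h : phi (c *: h) = c * phi h.
  by have := philin c h 0; rewrite phi0 !addr0.
exists (phi (u \oc f) / phi (u \oc g)).
have ug : phi (u \oc g) != 0.
  apply/eqP => e; apply: g0; rewrite -(comp1m g) -vu -mcompA.
  by rewrite (phi_inj (u \oc g) 0) ?comp0r// phi0.
rewrite -[LHS]comp1m -[RHS]comp1m -vu -!mcompA; congr (_ \oc _).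
by apply: phi_inj; rewrite compZr phiZ divfK.
Qed.

Lemma finite_sum_of_imp C (P Q : C -> Prop) (X : C) :
  (forall A, P A -> Q A) -> finite_sum_of P X -> finite_sum_of Q X.
Proof.
move=> PQ; elim=> [Y|A B W /PQ QA _ QB]; first exact: finite_sum_nil.
exact: finite_sum_cons.
Qed.

Lemma full_subcategory_additive C (P : C -> Prop) : additive_category C ->
  is_subcategory P -> additive_category (full_subcategory P).
Proof.
move=> [[Z Z0] sums] [P0 PS]; split.
  by exists (exist P Z (P0 Z Z0)) => Y; exact: Z0 (sval Y).
move=> [A PA] [B PB]; have [W AB] := sums A B.
by exists (exist P W ((PS A B W AB).2 (conj PA PB))); exact: AB.
Qed.

Lemma finite_sum_of_full C (P Q : C -> Prop) (X : C) (PX : P X) :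
  is_subcategory P -> finite_sum_of Q X ->
  finite_sum_of (fun A : full_subcategory P => Q (sval A)) (exist P X PX).
Proof.
move=> [P0 PS] QX; elim: QX PX => [Y Y0|A B W QA _ IH AB] PX.
  by apply: finite_sum_nil => A; exact: Y0 (sval A).
have [PA PB] := (PS _ _ _ AB).1 PX.
by apply: (@finite_sum_cons K (full_subcategory P) (fun A => Q (sval A))
  (exist P A PA) (exist P B PB) (exist P W PX) QA (IH PB)); exact: AB.
Qed.

(** * Functors and quasi-inverses *)

Lemma functor_isom C D (F : functor C D) (X Y : C) :
  isom X Y -> isom (F X) (F Y).
Proof.
move=> [f [g [gf fg]]]; exists (Defs.fmap F f), (Defs.fmap F g).
by rewrite -!Defs.fmap_comp gf fg !Defs.fmap_id.
Qed.

Lemma linear_functor0 C D (F : functor C D) (X Y : C) :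
  linear_functor F -> Defs.fmap F (0 : mor X Y) = 0.
Proof.
move=> Flin; have := Flin X Y (-1) 0 0.
by rewrite scaler0 add0r scaleN1r addNr.
Qed.

Lemma linear_functorD C D (F : functor C D) (X Y : C) (f g : mor X Y) :
  linear_functor F -> Defs.fmap F (f + g) = Defs.fmap F f + Defs.fmap F g.
Proof. by move=> Flin; have := Flin X Y 1 f g; rewrite !scale1r. Qed.

Lemma linear_functor_zero C D (F : functor C D) (X : C) :
  linear_functor F -> is_zero X -> is_zero (F X).
Proof.
move=> Flin /is_zeroP X0; apply/is_zeroP.
by rewrite -Defs.fmap_id X0 linear_functor0.
Qed.

Lemma linear_functor_sum C D (F : functor C D) (A B W : C) :
  linear_functor F -> is_sum A B W -> is_sum (F A) (F B) (F W).
Proof.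
move=> Flin [i1 [i2 [p1 [p2 [pi1 pi2 e12 e21 e]]]]].
exists (Defs.fmap F i1), (Defs.fmap F i2), (Defs.fmap F p1), (Defs.fmap F p2); split.
- by rewrite -Defs.fmap_comp pi1 Defs.fmap_id.
- by rewrite -Defs.fmap_comp pi2 Defs.fmap_id.
- by rewrite -Defs.fmap_comp e12 linear_functor0.
- by rewrite -Defs.fmap_comp e21 linear_functor0.
- by rewrite -!Defs.fmap_comp -linear_functorD// e Defs.fmap_id.
Qed.

Lemma quasi_inverse_sym C D (F : functor C D) (G : functor D C) :
  quasi_inverse F G -> quasi_inverse G F.
Proof. by case. Qed.

Lemma quasi_inverse_isom C D (F : functor C D) (G : functor D C) :
  quasi_inverse F G -> forall X : C, isom (G (F X)) X.
Proof. by move=> [[t [ti _]] _] X; exists (t X); exact: ti. Qed.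

(** Naturality in its working form: [G] after [F] acts on morphisms as conjugation by [t].
    Faithfulness, fullness and linearity are all derived from it. *)
Lemma quasi_inverse_conj C D (F : functor C D) (G : functor D C) :
  quasi_inverse F G -> exists (t : forall X : C, mor (G (F X)) X)
    (k : forall X : C, mor X (G (F X))),
  [/\ forall X, k X \oc t X = idmor (G (F X)),
      forall X, t X \oc k X = idmor X
    & forall (X Y : C) (f : mor X Y),
        Defs.fmap G (Defs.fmap F f) = k Y \oc f \oc t X].
Proof.
move=> [[t [ti tn]] _].
have tk (X : C) : {k : mor X (G (F X)) | k \oc t X = idmor (G (F X)) /\
    t X \oc k = idmor X} by apply: cid; exact: ti.
exists t, (fun X => sval (tk X)); split=> [X|X|X Y f].
- by case: (svalP (tk X)).
- by case: (svalP (tk X)).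
- case: (svalP (tk Y)) => ktY _; rewrite -mcompA.
  rewrite -[f \oc t X](tn X Y f) mcompA [X in X \oc _]ktY.
  by rewrite comp1m.
Qed.

Lemma quasi_inverse_faithful C D (F : functor C D) (G : functor D C) :
  quasi_inverse F G ->
  forall (X Y : C) (f g : mor X Y), Defs.fmap F f = Defs.fmap F g -> f = g.
Proof.
move=> /quasi_inverse_conj[t [k [kt tk e]]] X Y f g fg.
have key (u : mor X Y) : u = t Y \oc Defs.fmap G (Defs.fmap F u) \oc k X.
  by rewrite e !mcompA tk comp1m -mcompA tk compm1.
by rewrite (key f) (key g) fg.
Qed.

Lemma quasi_inverse_full C D (F : functor C D) (G : functor D C) :
  quasi_inverse F G -> forall (X Y : C) (g : mor (F X) (F Y)),
  exists f : mor X Y, Defs.fmap F f = g.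
Proof.
move=> FG X Y g; have [t [k [kt tk e]]] := quasi_inverse_conj FG.
exists (t Y \oc Defs.fmap G g \oc k X).
(* [G] is faithful too, so it is enough to compare the images under [G], where the conjugations
   cancel. *)
apply: (quasi_inverse_faithful (quasi_inverse_sym FG)).
by rewrite e !mcompA kt comp1m -mcompA kt compm1.
Qed.

Lemma quasi_inverse_linear C D (F : functor C D) (G : functor D C) :
  quasi_inverse F G -> linear_functor F -> linear_functor G.
Proof.
move=> FG Flin X Y c f g; apply: (quasi_inverse_faithful FG).
have [t [k [_ _ e]]] := quasi_inverse_conj (quasi_inverse_sym FG).
by rewrite e Flin !e compDr compDl compZr compZl.
Qed.

End LinearCategoryTheory.

(** * Triangulated categories and torsion pairs *)

Section TriangulatedTheory.
Variables (K : fieldType) (T : tricat K).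
Notation S := (susp T).
Notation D := (desusp T).
Local Open Scope ring_scope.

Lemma desusp_linear : linear_functor D.
Proof.
by apply: (@quasi_inverse_linear _ _ _ _ _ (susp_desusp T)); exact: susp_linear.
Qed.

Lemma desusp_susp (X : T) : isom (D (S X)) X.
Proof. exact: quasi_inverse_isom (susp_desusp T) X. Qed.

Lemma susp_desuspK (X : T) : isom (S (D X)) X.
Proof. exact: quasi_inverse_isom (quasi_inverse_sym (susp_desusp T)) X. Qed.

Lemma exists_zero : exists X : T, is_zero X.
Proof. by case: (tcat_additive T). Qed.

Lemma susp_eq0 (X Y : T) (f : mor X Y) : Defs.fmap S f = 0 -> f = 0.
Proof.
move=> f0; apply: (quasi_inverse_faithful (susp_desusp T)).
by rewrite f0 linear_functor0//; exact: susp_linear.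
Qed.

Lemma susp_full (X Y : T) (g : mor (S X) (S Y)) : exists f, Defs.fmap S f = g.
Proof. by apply: (quasi_inverse_full (susp_desusp T)). Qed.

Lemma iter_isom (F : functor T T) m (X Y : T) :
  isom X Y -> isom (iter m (fob F) X) (iter m (fob F) Y).
Proof. by elim: m => // m IH XY; exact/functor_isom/IH. Qed.

Lemma iter_cancel (F G : functor T T) m (X : T) :
  (forall Y, isom (F (G Y)) Y) ->
  isom (iter m (fob F) (iter m (fob G) X)) X.
Proof.
move=> FG; elim: m => [|m IH]; first exact: isom_refl.
by rewrite iterSr; apply: isom_trans IH; exact/iter_isom/FG.
Qed.

Lemma suspz_isom k (X Y : T) : isom X Y -> isom (suspz k X) (suspz k Y).
Proof. by case: k => m XY; exact: iter_isom. Qed.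

Lemma suspzN k (X : T) : isom (suspz (- k) (suspz k X)) X.
Proof.
case: k => [[|m]|m]; first exact: isom_refl.
- exact: (@iter_cancel D S m.+1 X desusp_susp).
- exact: (@iter_cancel S D m.+1 X susp_desuspK).
Qed.

Lemma iter_sum (F : functor T T) m (A B W : T) : linear_functor F ->
  is_sum A B W ->
  is_sum (iter m (fob F) A) (iter m (fob F) B) (iter m (fob F) W).
Proof.
by move=> Flin AB; elim: m => //= m IH; exact: linear_functor_sum Flin IH.
Qed.

Lemma iter_zero (F : functor T T) m (A : T) : linear_functor F ->
  is_zero A -> is_zero (iter m (fob F) A).
Proof.
by move=> Flin A0; elim: m => //= m IH; exact: linear_functor_zero Flin IH.
Qed.

Lemma suspz_sum k (A B W : T) :
  is_sum A B W -> is_sum (suspz k A) (suspz k B) (suspz k W).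
Proof.
by case: k => m; apply: iter_sum; [exact: susp_linear|exact: desusp_linear].
Qed.

Lemma suspz_zero k (A : T) : is_zero A -> is_zero (suspz k A).
Proof.
by case: k => m; apply: iter_zero; [exact: susp_linear|exact: desusp_linear].
Qed.

(** Subcategories are closed under isomorphism, so membership in a shift can be tested by shifting
    back. *)
Lemma shift_subE k (P : T -> Prop) (A : T) : is_subcategory P ->
  shift_sub k P A <-> P (suspz (- k) A).
Proof.
move=> Psub; split=> [[B PB AB]|PA]; last first.
  by exists (suspz (- k) A) => //; rewrite -{1}(opprK k); exact/isom_sym/suspzN.
apply: (sub_isom exists_zero Psub _ PB); apply/isom_sym.
by apply: isom_trans (suspzN k B); exact: suspz_isom.
Qed.

Lemma shift_sub_zero k (P : T -> Prop) (A : T) : is_subcategory P ->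
  is_zero A -> shift_sub k P A.
Proof. by move=> Psub A0; apply/shift_subE => //; exact/(proj1 Psub)/suspz_zero. Qed.

(** * Distinguished triangles and split triangles *)

Lemma dist_comp0 (X Y Z : T) (f : mor X Y) (g : mor Y Z) (h : mor Z (S X)) :
  triangle f g h -> g \oc f = 0.
Proof.
move=> fgh; have [Z0 Z00] := exists_zero.
(* The identity triangle of [X] maps to the given one, which factors [g \oc f] through a zero
   object. *)
have [w [<- _]] := dist_morph (u := idmor X) (v := f) (dist_id X Z00) fgh
  (erefl _).
by rewrite comp0r.
Qed.

(** The factorization is the third component of a morphism into the triangle on [Z0], [W], [W] with
    [Z0] zero, a rotation of the identity triangle of [W]. *)
Lemma dist_factor (X Y Z : T) (f : mor X Y) (g : mor Y Z) (h : mor Z (S X))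
    (W : T) (v : mor Y W) :
  triangle f g h -> v \oc f = 0 -> exists w : mor Z W, w \oc g = v.
Proof.
move=> fgh vf; have [Z0 Z00] := exists_zero.
have SZ0 : is_zero (S Z0) := linear_functor_zero (@susp_linear _ T) Z00.
have tri : triangle (0 : mor Z0 W) (idmor W) (0 : mor W (S Z0)).
  apply/dist_rot; rewrite linear_functor0 ?oppr0; last exact: susp_linear.
  exact: dist_id.
have [|w [wg _]] := dist_morph (u := 0) (v := v) fgh tri.
  by rewrite vf comp0l.
by exists w; rewrite wg comp1m.
Qed.

(** A zero first map gives a retraction [r] of [g]; the remainder [idmor C - g \oc r] factors
    through [h] by some [s], and [h] being epi forces the other biproduct identities. *)
Lemma dist0_sum (A B C : T) (g : mor B C) (h : mor C (S A)) :
  triangle (0 : mor A B) g h -> is_sum B (S A) C.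
Proof.
move=> tri; have [r rg] := dist_factor (v := idmor B) tri (comp0r _ _).
have tri' := (dist_rot _ _ _).1 tri.
have hg := dist_comp0 tri'.
have [|s sh] := dist_factor (v := idmor C - g \oc r) tri'.
  by rewrite compBl comp1m -mcompA rg compm1 subrr.
rewrite linear_functor0 ?oppr0 in tri'; last exact: susp_linear.
have tri2 := (dist_rot _ _ _).1 tri'.
(* [h] is an epimorphism, because the map after it in the rotated triangle is zero. *)
have hK (W : T) (u : mor (S A) W) : u \oc h = 0 -> u = 0.
  move=> uh; have [w <-] := dist_factor tri2 uh.
  by rewrite comp0r.
exists g, s, r, h; split=> //.
- apply/eqP; rewrite -subr_eq0; apply/eqP/hK.
  by rewrite compBl comp1m -mcompA sh compBr compm1 mcompA hg comp0l subr0 subrr.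
- by apply: hK; rewrite -mcompA sh compBr compm1 mcompA rg comp1m subrr.
- by rewrite sh addrC subrK.
Qed.

(** * Torsion pairs and hearts *)

Lemma torsion_pair_orth (X Y : T -> Prop) (B : T) : torsion_pair X Y ->
  Y B <-> forall A, X A -> forall f : mor A B, f = 0.
Proof.
move=> [_ [_ YS] XY0 XYtri]; split=> [YB A XA f|B0]; first exact: XY0.
have [A [C [f [g [h [XA YC tri]]]]]] := XYtri B.
(* With the first map zero the triangle splits, and [B] is a summand of the object [C] of [Y]. *)
have f0 := B0 A XA f; rewrite {}f0 in tri.
by have /(YS _ _ _ (dist0_sum tri))[] := YC.
Qed.

(** Suspension is full and faithful, so maps into the desuspension of [B] correspond to maps from
    suspended objects into [B]. This exhibits the shifted coaisle as a right orthogonal, hence as a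
    subcategory. *)
Lemma torsion_pair_shift (X Y : T -> Prop) (B : T) : torsion_pair X Y ->
  shift_sub 1 Y B <-> forall A, X A -> forall f : mor (S A) B, f = 0.
Proof.
move=> XY; have Ysub : is_subcategory Y by case: XY.
have [u [v [vu uv]]] := susp_desuspK B.
rewrite shift_subE//; rewrite (torsion_pair_orth _ XY); split=> B0 A XA f.
- have [g gf] := susp_full (v \oc f).
  by rewrite -(comp1m f) -uv -mcompA -gf (B0 _ XA g) linear_functor0 ?comp0r//;
    exact: susp_linear.
- apply: susp_eq0.
  by rewrite -[Defs.fmap _ _]comp1m -vu -mcompA (B0 _ XA (u \oc _)) comp0r.
Qed.

Lemma heart_sub (X Y : T -> Prop) : torsion_pair X Y ->
  is_subcategory (fun A => X A /\ shift_sub 1 Y A).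
Proof.
move=> XY; have Xsub : is_subcategory X by case: XY.
apply: sub_and => //.
have /funext-> : shift_sub 1 Y =1 fun B : T =>
    forall A, (exists2 A', X A' & A = S A') -> forall f : mor A B, f = 0.
  move=> B; apply/propext; rewrite (torsion_pair_shift _ XY); split=> B0 A.
    by move=> [A' XA' ->]; exact: B0.
  by move=> XA; apply: B0; exists A.
exact: right_orth_sub.
Qed.

End TriangulatedTheory.

(** * Semisimple categories *)

Section SemisimpleCategories.
Local Open Scope ring_scope.
Variable K : fieldType.
Implicit Types C D : lincat K.

Definition brick_family C n (E : 'I_n -> C) : Prop :=
  [/\ forall i, idmor (E i) <> 0,
      forall i (f : mor (E i) (E i)), exists c, f = c *: idmor (E i)
    & forall i j (f : mor (E i) (E j)), i <> j -> f = 0].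

(** An [m]-fold biproduct; repetitions in [j] record multiplicities, and [m = 0] describes zero
    objects. *)
Definition decomposition C n (E : 'I_n -> C) (X : C) m (j : 'I_m -> 'I_n)
    (s : forall k, mor (E (j k)) X) (p : forall k, mor X (E (j k))) : Prop :=
  [/\ forall k, p k \oc s k = idmor (E (j k)),
      forall k l, k <> l -> p k \oc s l = 0
    & \sum_k s k \oc p k = idmor X].

(** Sharing one index family matches objects of the two categories by their multiplicities. It is
    data rather than a proposition because functors are defined from it. *)
Record common_decomposition C D n (E : 'I_n -> C) (E' : 'I_n -> D)
    (X : C) (X' : D) := CommonDecomposition {
  cd_size : nat;
  cd_index : 'I_cd_size -> 'I_n;
  cd_s : forall k, mor (E (cd_index k)) X;
  cd_p : forall k, mor X (E (cd_index k));
  cd_s' : forall k, mor (E' (cd_index k)) X';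
  cd_p' : forall k, mor X' (E' (cd_index k));
  cd_dec : decomposition cd_s cd_p;
  cd_dec' : decomposition cd_s' cd_p'
}.

Arguments cd_s {C D n E E' X X'} c k.
Arguments cd_p {C D n E E' X X'} c k.
Arguments cd_s' {C D n E E' X X'} c k.
Arguments cd_p' {C D n E E' X X'} c k.

Definition cd_sym C D n (E : 'I_n -> C) (E' : 'I_n -> D) X X'
    (d : common_decomposition E E' X X') : common_decomposition E' E X' X :=
  CommonDecomposition (cd_dec' d) (cd_dec d).

Record family_iso C D n (E : 'I_n -> C) (E' : 'I_n -> D) := FamilyIso {
  fi_map : forall i j, mor (E i) (E j) -> mor (E' i) (E' j);
  fi_inv : forall i j, mor (E' i) (E' j) -> mor (E i) (E j);
  fi_mapK : forall i j, cancel (@fi_map i j) (@fi_inv i j);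
  fi_invK : forall i j, cancel (@fi_inv i j) (@fi_map i j);
  fi_map_linear : forall i j, linear (@fi_map i j);
  fi_inv_linear : forall i j, linear (@fi_inv i j);
  fi_map_id : forall i, fi_map (idmor (E i)) = idmor (E' i);
  fi_inv_id : forall i, fi_inv (idmor (E' i)) = idmor (E i);
  fi_map_comp : forall i j k (g : mor (E j) (E k)) (f : mor (E i) (E j)),
    fi_map (g \oc f) = fi_map g \oc fi_map f;
  fi_inv_comp : forall i j k (g : mor (E' j) (E' k)) (f : mor (E' i) (E' j)),
    fi_inv (g \oc f) = fi_inv g \oc fi_inv f
}.

Definition fi_sym C D n (E : 'I_n -> C) (E' : 'I_n -> D)
    (t : family_iso E E') : family_iso E' E :=
  FamilyIso (fi_invK t) (fi_mapK t) (fi_inv_linear t) (fi_map_linear t)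
    (fi_inv_id t) (fi_map_id t) (fi_inv_comp t) (fi_map_comp t).

(** * Transfer of morphisms along common decompositions *)

Section Transfer.
Variables (C D : lincat K) (n : nat) (E : 'I_n -> C) (E' : 'I_n -> D).
Variable t : family_iso E E'.

Lemma fi_map0 i j : fi_map t (0 : mor (E i) (E j)) = 0.
Proof.
have := fi_map_linear t (-1) (0 : mor (E i) (E j)) 0.
by rewrite scaler0 add0r scaleN1r addNr.
Qed.

Lemma fi_mapD i j (f g : mor (E i) (E j)) :
  fi_map t (f + g) = fi_map t f + fi_map t g.
Proof. by have := fi_map_linear t 1 f g; rewrite !scale1r. Qed.

Lemma fi_map_sum i j m (F : 'I_m -> mor (E i) (E j)) :
  fi_map t (\sum_k F k) = \sum_k fi_map t (F k).
Proof. exact: (big_morph _ (@fi_mapD i j) (fi_map0 i j)). Qed.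

(** Morphisms between sums of bricks are matrices of morphisms between bricks. *)
Definition transfer X X' Y Y' (d : common_decomposition E E' X X')
    (e : common_decomposition E E' Y Y') (f : mor X Y) : mor X' Y' :=
  \sum_l \sum_k cd_s' e l \oc fi_map t (cd_p e l \oc f \oc cd_s d k)
    \oc cd_p' d k.

(** Orthogonality of the inclusions and projections leaves one term of the double sum. Together with
    [decomposition_ext] this reduces identities between transferred morphisms to matrix entries. *)
Lemma transfer_comp_entry X X' Y Y' (d : common_decomposition E E' X X')
    (e : common_decomposition E E' Y Y') (f : mor X Y) l k :
  cd_p' e l \oc transfer d e f \oc cd_s' d k =
  fi_map t (cd_p e l \oc f \oc cd_s d k).
Proof.
have [psd psd0 _] := cd_dec' d; have [pse pse0 _] := cd_dec' e.
rewrite /transfer comp_sumr comp_suml (bigD1 l)//= [X in _ + X]big1 ?addr0.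
  rewrite comp_sumr comp_suml (bigD1 k)//= [X in _ + X]big1 ?addr0.
    by rewrite !mcompA pse comp1m -!mcompA psd compm1.
  move=> q /eqP qk.
  by rewrite -!mcompA psd0// !comp0r.
move=> q /eqP ql; rewrite comp_sumr comp_suml big1// => r _.
by rewrite !mcompA pse0 ?comp0l//; exact/nesym.
Qed.

Lemma decomposition_ext (B : lincat K) (F : 'I_n -> B) X Y m m'
    (j : 'I_m -> 'I_n) s p (j' : 'I_m' -> 'I_n) s' p' (u v : mor X Y) :
  @decomposition B n F X m j s p -> @decomposition B n F Y m' j' s' p' ->
  (forall l k, p' l \oc u \oc s k = p' l \oc v \oc s k) -> u = v.
Proof.
move=> [_ _ sp] [_ _ sp'] uv.
have expand (w : mor X Y) :
    w = \sum_l \sum_k s' l \oc (p' l \oc w \oc s k) \oc p k.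
  rewrite -[w in LHS]comp1m -sp' comp_suml; apply: eq_bigr => l _.
  rewrite -[w in LHS]compm1 -sp !comp_sumr; apply: eq_bigr => k _.
  by rewrite !mcompA.
rewrite (expand u) (expand v); apply: eq_bigr => l _; apply: eq_bigr => k _.
by rewrite uv.
Qed.

Lemma decomposition_mid (B : lincat K) (F : 'I_n -> B) X Y Z m
    (j : 'I_m -> 'I_n) s p (g : mor X Y) (f : mor Z X) :
  @decomposition B n F X m j s p ->
  g \oc f = \sum_q (g \oc s q) \oc (p q \oc f).
Proof.
move=> [_ _ sp]; rewrite -[f in LHS]comp1m -sp comp_suml comp_sumr.
by apply: eq_bigr => q _; rewrite !mcompA.
Qed.

Lemma transfer_linear X X' Y Y' (d : common_decomposition E E' X X')
    (e : common_decomposition E E' Y Y') : linear (transfer d e).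
Proof.
move=> c f g; apply: (decomposition_ext (cd_dec' d) (cd_dec' e)) => l k.
rewrite compDr compDl compZr compZl !transfer_comp_entry -fi_map_linear.
by rewrite compDr compDl compZr compZl.
Qed.

Lemma transfer_id X X' (d : common_decomposition E E' X X') :
  transfer d d (idmor X) = idmor X'.
Proof.
apply: (decomposition_ext (cd_dec' d) (cd_dec' d)) => l k.
rewrite transfer_comp_entry !compm1.
have [<-|/eqP lk] := eqVneq l k.
  by have [-> _ _] := cd_dec d; have [-> _ _] := cd_dec' d; rewrite fi_map_id.
have [_ -> // _] := cd_dec d; have [_ -> // _] := cd_dec' d.
exact: fi_map0.
Qed.

Lemma transfer_comp X X' Y Y' Z Z' (d : common_decomposition E E' X X')
    (e : common_decomposition E E' Y Y') (h : common_decomposition E E' Z Z')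
    (g : mor Y Z) (f : mor X Y) :
  transfer d h (g \oc f) = transfer e h g \oc transfer d e f.
Proof.
apply: (decomposition_ext (cd_dec' d) (cd_dec' h)) => l k.
rewrite transfer_comp_entry.
have -> : cd_p h l \oc (g \oc f) \oc cd_s d k =
    (cd_p h l \oc g) \oc (f \oc cd_s d k) by rewrite !mcompA.
have -> : cd_p' h l \oc (transfer e h g \oc transfer d e f) \oc cd_s' d k =
    (cd_p' h l \oc transfer e h g) \oc (transfer d e f \oc cd_s' d k).
  by rewrite !mcompA.
rewrite (decomposition_mid _ _ (cd_dec e)) (decomposition_mid _ _ (cd_dec' e)).
rewrite fi_map_sum; apply: eq_bigr => q _; rewrite fi_map_comp.
by rewrite !mcompA -transfer_comp_entry -!mcompA [cd_p e q \oc _]mcompA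
  -transfer_comp_entry !mcompA.
Qed.

End Transfer.

Lemma transferK C D n (E : 'I_n -> C) (E' : 'I_n -> D) (t : family_iso E E')
    X X' Y Y' (d : common_decomposition E E' X X')
    (e : common_decomposition E E' Y Y') :
  cancel (transfer t d e) (transfer (fi_sym t) (cd_sym d) (cd_sym e)).
Proof.
move=> f; apply: (decomposition_ext (cd_dec d) (cd_dec e)) => l k.
have := @transfer_comp_entry _ _ _ _ _ (fi_sym t) _ _ _ _ (cd_sym d) (cd_sym e)
  (transfer t d e f) l k.
by rewrite /= transfer_comp_entry fi_mapK.
Qed.

(** Both functors send an object to a chosen partner and transfer morphisms. The choices in the two
    directions are independent, so the composites are only isomorphic to the identity functors. *)
Lemma common_decomposition_equivalence C D n (E : 'I_n -> C) (E' : 'I_n -> D) :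
  family_iso E E' ->
  (forall X, exists X', inhabited (common_decomposition E E' X X')) ->
  (forall X', exists X, inhabited (common_decomposition E E' X X')) ->
  linearly_equivalent C D.
Proof.
move=> t decC decD.
have {}decC X : {X' & common_decomposition E E' X X'}.
  have /cid[X' XX'] := decC X; exists X'.
  by have [] : {d : common_decomposition E E' X X' | True}
    by apply: cid; case: XX' => d; exists d.
have {}decD X' : {X & common_decomposition E E' X X'}.
  have /cid[X XX'] := decD X'; exists X.
  by have [] : {d : common_decomposition E E' X X' | True}
    by apply: cid; case: XX' => d; exists d.
pose d X := projT2 (decC X); pose e X' := projT2 (decD X').
pose F := @Functor K C D (fun X => projT1 (decC X))
  (fun X Y => transfer t (d X) (d Y)) (fun X => transfer_id t (d X))
  (fun X Y Z => transfer_comp t (d X) (d Y) (d Z)).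
pose u := fi_sym t; pose e' X' := cd_sym (e X').
pose G := @Functor K D C (fun X' => projT1 (decD X'))
  (fun X Y => transfer u (e' X) (e' Y)) (fun X => transfer_id u (e' X))
  (fun X Y Z => transfer_comp u (e' X) (e' Y) (e' Z)).
exists F, G; split; first by move=> X Y; exact: transfer_linear.
have tK X X' Y Y' (a : common_decomposition E E' X X')
    (b : common_decomposition E E' Y Y') (f : mor X' Y') :
    transfer t a b (transfer u (cd_sym a) (cd_sym b) f) = f.
  exact: (transferK u (cd_sym a) (cd_sym b) f).
split.
(* [X] and [G (F X)] are both partners of [F X]; transferring the identity of [F X] along these two
   decompositions compares them. *)
- exists (fun X => transfer u (e' (F X)) (cd_sym (d X)) (idmor (F X))).
  split=> [X|X Y f].
  + exists (transfer u (cd_sym (d X)) (e' (F X)) (idmor (F X))).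
    by rewrite -!transfer_comp comp1m !transfer_id.
  + rewrite /= -transfer_comp comp1m.
    rewrite -[X in _ = X \oc _](transferK t (d X) (d Y)) -transfer_comp.
    by rewrite compm1.
- exists (fun X => transfer t (d (G X)) (e X) (idmor (G X))).
  split=> [X|X Y f].
  + exists (transfer t (e X) (d (G X)) (idmor (G X))).
    by rewrite -!transfer_comp comp1m !transfer_id.
  + rewrite /= -transfer_comp comp1m.
    by rewrite -[X in _ = X \oc _](tK _ _ _ _ (e X) (e Y)) -transfer_comp compm1.
Qed.

(** The identity, transported along a decided equality of indices, so that one scalar describes a
    morphism between any two bricks. *)
Definition brick_id C n (E : 'I_n -> C) (i j : 'I_n) : mor (E i) (E j) :=
  match i =P j with
  | ReflectT ij => eq_rect i (fun k => mor (E i) (E k)) (idmor (E i)) j ij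
  | ReflectF _ => 0
  end.

Lemma brick_idii C n (E : 'I_n -> C) i : brick_id E i i = idmor (E i).
Proof.
by rewrite /brick_id; case: eqP => // ii; rewrite (eq_axiomK ii).
Qed.

(** The vanishing assumptions matter when [i = k] differs from [j]: the left side is zero there,
    while [brick_id E i k] is an identity. *)
Lemma brick_id_comp C n (E : 'I_n -> C) i j k (x y : K) :
  (i <> j -> x = 0) -> (j <> k -> y = 0) ->
  y *: brick_id E j k \oc (x *: brick_id E i j) = (y * x) *: brick_id E i k.
Proof.
case: (i =P j) => [ij _|ij /(_ ij)-> _]; last first.
  by rewrite mulr0 !scale0r comp0r.
subst j; case: (i =P k) => [ik _|ik /(_ ik)->]; last first.
  by rewrite mul0r !scale0r comp0l.
by subst k; rewrite !brick_idii compZl compZr comp1m scalerA.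
Qed.

Lemma brick_coef C n (E : 'I_n -> C) : brick_family E ->
  exists c : forall i j, mor (E i) (E j) -> K,
  [/\ forall i j (f : mor (E i) (E j)), f = c i j f *: brick_id E i j,
      forall i j (f : mor (E i) (E j)), i <> j -> c i j f = 0
    & forall i j x, (i <> j -> x = 0) -> c i j (x *: brick_id E i j) = x].
Proof.
move=> [E0 E1 E2].
have ex i j (f : mor (E i) (E j)) :
    {c | f = c *: brick_id E i j & i <> j -> c = 0}.
  apply: cid2; case: (i =P j) => ij; last first.
    by exists 0 => //; rewrite scale0r; exact: E2.
  by subst j; have [c fc] := E1 i f; exists c; rewrite ?brick_idii.
exists (fun i j f => s2val (ex i j f)); split=> [i j f|i j f|i j x].
- by case: (ex i j f).
- by case: (ex i j f).
- case: (ex i j _) => y /= xy y0; case: (i =P j) => ij; last first.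
    by move=> /(_ ij)->; exact: y0.
  move=> _; subst j; apply/eqP; move/eqP: xy.
  rewrite brick_idii eq_sym -subr_eq0 -scalerBl scaler_eq0 subr_eq0.
  by case/orP => // /eqP /E0.
Qed.

Lemma brick_family_iso C D n (E : 'I_n -> C) (E' : 'I_n -> D) :
  brick_family E -> brick_family E' -> inhabited (family_iso E E').
Proof.
(* Stated for arbitrary families, to be used once in each direction. *)
have key (A B : lincat K) (F : 'I_n -> A) (F' : 'I_n -> B)
    (c : forall i j, mor (F i) (F j) -> K) :
    (forall i j (f : mor (F i) (F j)), f = c i j f *: brick_id F i j) ->
    (forall i j (f : mor (F i) (F j)), i <> j -> c i j f = 0) ->
    (forall i j x, (i <> j -> x = 0) -> c i j (x *: brick_id F i j) = x) ->
  let h i j f := c i j f *: brick_id F' i j in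
  [/\ forall i j, linear (h i j), forall i, h i i (idmor (F i)) = idmor (F' i)
    & forall i j k (g : mor (F j) (F k)) (f : mor (F i) (F j)),
        h i k (g \oc f) = h j k g \oc h i j f].
  move=> fc c0 cK h; split=> [i j x f g|i|i j k g f].
  - rewrite /h {1}(fc _ _ f) {1}(fc _ _ g) scalerA -scalerDl cK.
      by rewrite scalerDl scalerA.
    by move=> ij; rewrite !c0// mulr0 addr0.
  - by rewrite /h -brick_idii -{1}(scale1r (brick_id _ _ _)) cK// scale1r brick_idii.
  - rewrite /h brick_id_comp; [|exact: c0|exact: c0].
    rewrite {1}(fc _ _ f) {1}(fc _ _ g) brick_id_comp; [|exact: c0|exact: c0].
    rewrite cK// => ik; case: (i =P j) => ij; last by rewrite (c0 i j)// mulr0.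
    by rewrite (c0 j k) ?mul0r// -ij.
move=> /brick_coef[c [fc c0 cK]] /brick_coef[c' [fc' c0' cK']].
have [h1 h2 h3] := key _ _ _ E' c fc c0 cK.
have [g1 g2 g3] := key _ _ _ E c' fc' c0' cK'.
have hK i j : cancel (fun f => c i j f *: brick_id E' i j)
    (fun f => c' i j f *: brick_id E i j).
  by move=> f; rewrite cK' -?fc//; exact: c0.
have gK i j : cancel (fun f => c' i j f *: brick_id E i j)
    (fun f => c i j f *: brick_id E' i j).
  by move=> f; rewrite cK -?fc'//; exact: c0'.
exact: inhabits (FamilyIso hK gK h1 g1 h2 g2 h3 g3).
Qed.

(** * Construction of decompositions *)

Lemma decomposition_nil C n (E : 'I_n -> C) (X : C) (j : 'I_0 -> 'I_n) :
  is_zero X -> exists s p, @decomposition C n E X 0 j s p.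
Proof.
move=> X0; have no (T : 'I_0 -> Type) k : T k by case: k.
exists (no _), (no _).
by split; [case|case|rewrite big_ord0 (is_zeroP _).1].
Qed.

(** Prepends a value to a dependent family. The value at [k] is characterized by transports along
    all equalities ending in [k], which are trivial since equality of ordinals is
    proof-irrelevant. *)
Lemma dfun_ord_recl m (T : 'I_m.+1 -> Type) (x : T ord0)
    (f : forall k, T (lift ord0 k)) :
  exists g : forall k, T k, g ord0 = x /\ forall k, g (lift ord0 k) = f k.
Proof.
have ex k : {y : T k | (forall e : ord0 = k, y = eq_rect _ T x _ e) /\
    forall l (e : lift ord0 l = k), y = eq_rect _ T (f l) _ e}.
  apply: cid; case: (unliftP ord0 k) => [l kl|k0].
  - subst k; exists (f l); split=> [e|l' e].
      by case/eqP: (neq_lift ord0 l).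
    have ll' := lift_inj e; subst l'.
    by rewrite (eq_axiomK e).
  - subst k; exists x; split=> [e|l e]; first by rewrite (eq_axiomK e).
    by case/eqP: (neq_lift ord0 l).
exists (fun k => sval (ex k)); split=> [|k].
- by have [yx _] := svalP (ex ord0); rewrite (yx erefl).
- by have [_ yf] := svalP (ex (lift ord0 k)); rewrite (yf _ erefl).
Qed.

Lemma decomposition_cons C n (E : 'I_n -> C) (B W : C) m (j : 'I_m.+1 -> 'I_n) :
  is_sum (E (j ord0)) B W ->
  (exists s p, @decomposition C n E B m (j \o lift ord0) s p) ->
  exists s p, @decomposition C n E W m.+1 j s p.
Proof.
move=> [i1 [i2 [p1 [p2 [pi1 pi2 e12 e21 e]]]]] [s [p [ps ps0 sp]]].
have [s' [s'0 s'S]] := dfun_ord_recl (T := fun k => mor (E (j k)) W) i1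
  (fun k => i2 \oc s k).
have [p' [p'0 p'S]] := dfun_ord_recl (T := fun k => mor W (E (j k))) p1
  (fun k => p k \oc p2).
exists s', p'; split=> [k|k l|].
- case: (unliftP ord0 k) => [q|] ->; last by rewrite s'0 p'0.
  by rewrite s'S p'S -mcompA [p2 \oc _]mcompA pi2 comp1m ps.
- case: (unliftP ord0 k) => [q|] ->; case: (unliftP ord0 l) => [r|] -> //.
  + move=> qr; rewrite s'S p'S -mcompA [p2 \oc _]mcompA pi2 comp1m ps0// => qr'.
    by apply: qr; rewrite qr'.
  + by rewrite s'0 p'S -mcompA e21 comp0r.
  + by rewrite s'S p'0 mcompA e12 comp0l.
- rewrite big_ord_recl s'0 p'0 -e; congr (_ + _).
  under eq_bigr do rewrite s'S p'S mcompA -[_ \oc s _ \oc p _]mcompA.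
  by rewrite -comp_suml -comp_sumr sp compm1.
Qed.

Lemma exists_decomposition C n (E : 'I_n -> C) m (j : 'I_m -> 'I_n) :
  additive_category C ->
  exists (X : C) s p, @decomposition C n E X m j s p.
Proof.
move=> [[Z Z0] Csum]; elim: m j => [|m IH] j.
  by exists Z; exact: decomposition_nil.
have [B dB] := IH (j \o lift ord0).
have [W sW] := Csum (E (j ord0)) B.
by exists W; exact: decomposition_cons sW dB.
Qed.

Lemma finite_sum_decomposition C n (E : 'I_n -> C) (X : C) :
  finite_sum_of (fun A => exists i, isom A (E i)) X ->
  exists m (j : 'I_m -> 'I_n) s p, @decomposition C n E X m j s p.
Proof.
elim=> [Y Y0|A B W [i Ai] _ [m [j dB]] ABW].
  have no (k : 'I_0) : 'I_n by case: k.
  by exists 0%N, no; exact: decomposition_nil.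
have [j' [j'0 j'S]] := dfun_ord_recl (T := fun=> 'I_n) i j.
have {}j'S : j = j' \o lift ord0 by apply/funext => k; rewrite /= j'S.
exists m.+1, j'; subst j i; apply: decomposition_cons dB.
have [f [g [gf fg]]] := Ai.
have [i1 [i2 [p1 [p2 [pi1 pi2 e12 e21 e]]]]] := ABW.
exists (i1 \oc g), i2, (f \oc p1), p2; split=> //.
- by rewrite -mcompA [p1 \oc _]mcompA pi1 comp1m.
- by rewrite -mcompA e12 comp0r.
- by rewrite mcompA e21 comp0l.
- by rewrite -mcompA [g \oc _]mcompA gf comp1m.
Qed.

Lemma brick_families_equivalence C D n (E : 'I_n -> C) (E' : 'I_n -> D) :
  brick_family E -> brick_family E' ->
  (forall m (j : 'I_m -> 'I_n), exists X s p, @decomposition C n E X m j s p) ->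
  (forall m (j : 'I_m -> 'I_n), exists X s p, @decomposition D n E' X m j s p) ->
  (forall X, exists m (j : 'I_m -> 'I_n) s p, @decomposition C n E X m j s p) ->
  (forall X, exists m (j : 'I_m -> 'I_n) s p, @decomposition D n E' X m j s p) ->
  linearly_equivalent C D.
Proof.
move=> Ebr E'br sumC sumD decC decD.
have [t] := brick_family_iso Ebr E'br.
apply: (common_decomposition_equivalence t) => [X|X'].
- have [m [j [s [p dX]]]] := decC X.
  have [X' [s' [p' dX']]] := sumD m j.
  by exists X'; exact: inhabits (CommonDecomposition dX dX').
- have [m [j [s [p dX']]]] := decD X'.
  have [X [s' [p' dX]]] := sumC m j.
  by exists X; exact: inhabits (CommonDecomposition dX dX').
Qed.

(** * Bricks and their behaviour under equivalences *)

Lemma linearly_equivalent_equivalent C D :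
  linearly_equivalent C D -> equivalent C D.
Proof. by move=> [F [G [_ FG]]]; exists F, G. Qed.

(** Phrased without scalars, so that an equivalence that is not known to be linear can preserve
    it. *)
Definition brick C (X : C) : Prop :=
  idmor X <> 0 /\ forall f : mor X X, is_isom f \/ f = 0.

Lemma brick_family_brick C n (E : 'I_n -> C) i : brick_family E -> brick (E i).
Proof.
move=> [E0 E1 _]; split=> // f; have [c ->] := E1 i f.
have [->|c0] := eqVneq c 0; first by right; rewrite scale0r.
left; exists (c^-1 *: idmor (E i)); rewrite !compZl !compZr !comp1m !scalerA.
by rewrite mulVf// divff// scale1r.
Qed.

Lemma brick_family_isom C n (E : 'I_n -> C) i j :
  brick_family E -> isom (E i) (E j) -> i = j.
Proof.
move=> [E0 _ E2] [f [g [gf _]]]; apply: contrapT => ij; apply: (E0 i).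
by rewrite -gf (E2 _ _ f ij) comp0r.
Qed.

(** An equivalence is not assumed to be linear; it still maps [0] to [0],
    because [0 = 0 \oc g] for the [g] which it maps to [0]. *)
Lemma equivalence_brick C D (F : functor C D) (G : functor D C) (X : C) :
  quasi_inverse F G -> brick X -> brick (F X).
Proof.
move=> FG [X0 Xbr].
have FX0 : Defs.fmap F (0 : mor X X) = 0.
  have [g gE] := quasi_inverse_full FG (0 : mor (F X) (F X)).
  by rewrite -(comp0l _ g) Defs.fmap_comp gE comp0r.
split=> [F0|f'].
  by apply/X0/(quasi_inverse_faithful FG); rewrite Defs.fmap_id FX0.
have [f <-] := quasi_inverse_full FG f'.
have [[g [gf fg]]|->] := Xbr f; last by right.
by left; exists (Defs.fmap F g); rewrite -!Defs.fmap_comp gf fg !Defs.fmap_id.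
Qed.

(** [Q] labels the bricks of [C], with equal labels only on isomorphic objects. The [n] pairwise
    non-isomorphic [E' i] come back as bricks with distinct labels, and an injection of ['I_n] into
    itself reaches every label. *)
Lemma equivalence_brick_count C D n (E' : 'I_n -> D) (Q : C -> 'I_n -> Prop)
    (A : 'I_n -> Prop) :
  equivalent C D -> brick_family E' ->
  (forall X, brick X -> exists2 i, A i & Q X i) ->
  (forall X Y i, Q X i -> Q Y i -> isom X Y) -> forall i, A i.
Proof.
move=> [F [G FG]] E'br Cbr Qisom.
have GF := quasi_inverse_sym FG.
have ex i : {k | A k & Q (G (E' i)) k}.
  by apply/cid2/Cbr/(equivalence_brick GF)/brick_family_brick.
pose h i := s2val (ex i).
have hinj : injective h.
  move=> i j hij; apply: (brick_family_isom E'br).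
  apply: isom_trans (quasi_inverse_isom GF (E' j)).
  apply: isom_trans (isom_sym (quasi_inverse_isom GF (E' i))) _.
  apply: functor_isom; rewrite /h in hij.
  case: (ex i) (ex j) hij => [k /= _ ik] [l /= _ jl] kl; subst l.
  exact: Qisom ik jl.
move=> i; have [g _ hg] := injF_bij hinj.
by rewrite -(hg i) /h; case: (ex _).
Qed.

Lemma brick_local C (X : C) : brick X -> local_end X.
Proof.
move=> [X0 Xbr]; split=> // f g nf ng [h [hfg _]]; apply: X0; rewrite -hfg.
by have [//|->] := Xbr f; have [//|->] := Xbr g; rewrite addr0 comp0r.
Qed.

End SemisimpleCategories.

(** * Modules over a power of the field *)

Section PowerModules.
Local Open Scope ring_scope.
Variables (K : fieldType) (n : nat).
Notation A := {ffun 'I_n -> K}.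
Notation iota := (fun c : K => [ffun=> c] : A).
Notation Mod := (power_module_category K n).

Lemma linear_lfun (U V : vectType K) (f : U -> V) : linear f ->
  {g : 'Hom(U, V) | forall v, g v = f v}.
Proof.
move=> flin; pose F : {linear U -> V} :=
  HB.pack f (GRing.isLinear.Build K U V *:%R f flin).
by exists (linfun F) => v; rewrite lfunE.
Qed.

Definition modapp (U V : Mod) (f : mor U V) (v : fdmod_space U) :
  fdmod_space V := modhom_val f v.

Lemma modapp_ext (U V : Mod) (f g : mor U V) :
  (forall v, modapp f v = modapp g v) -> f = g.
Proof. by move=> fg; apply/val_inj/lfunP. Qed.

Lemma modapp_id (U : Mod) v : modapp (idmor U) v = v.
Proof. exact: id_lfunE. Qed.

Lemma modapp_comp (U V W : Mod) (g : mor V W) (f : mor U V) v :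
  modapp (g \oc f) v = modapp g (modapp f v).
Proof. exact: comp_lfunE. Qed.

Lemma modapp0 (U V : Mod) v : modapp (0 : mor U V) v = 0.
Proof. exact: zero_lfunE. Qed.

Lemma modappD (U V : Mod) (f g : mor U V) v :
  modapp (f + g) v = modapp f v + modapp g v.
Proof. exact: add_lfunE. Qed.

Lemma modapp_sum (U V : Mod) m (F : 'I_m -> mor U V) v :
  modapp (\sum_k F k) v = \sum_k modapp (F k) v.
Proof.
by elim/big_rec2: _ => [|k u f _ <-]; rewrite ?modapp0 ?modappD.
Qed.

Lemma modappZ (U V : Mod) c (f : mor U V) v : modapp (c *: f) v = c *: modapp f v.
Proof. exact: scale_lfunE. Qed.

Lemma modapp_linear (U V : Mod) (f : mor U V) c v :
  modapp f (c *: v) = c *: modapp f v.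
Proof. exact: linearZ. Qed.

Lemma modapp_act (U V : Mod) (f : mor U V) a v :
  modapp f (fdmod_act U a v) = fdmod_act V a (modapp f v).
Proof. exact: (equivariantP _ (modhomP f)). Qed.

Lemma modhom_of (U V : Mod) (f : fdmod_space U -> fdmod_space V) : linear f ->
  (forall a v, f (fdmod_act U a v) = fdmod_act V a (f v)) ->
  {g : mor U V | forall v, modapp g v = f v}.
Proof.
move=> /linear_lfun[g gf] fA.
have gA : g \in @equivariant _ _ _ U V.
  by apply/equivariantP => a v; rewrite !gf.
by exists (ModHom gA).
Qed.

(** * Direct sums of simple modules, and the simple modules themselves *)

Section WeightModule.
Variables (m : nat) (j : 'I_m -> 'I_n).

Definition weight_act (a : A) (v : 'rV[K]_m) : 'rV[K]_m :=
  \row_k (a (j k) * v ord0 k).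

Lemma weight_act_linear a : linear (weight_act a).
Proof. by move=> c u v; apply/rowP => k; rewrite !mxE mulrDr mulrCA. Qed.

HB.instance Definition _ a :=
  GRing.isLinear.Build K 'rV[K]_m 'rV[K]_m *:%R (weight_act a)
    (weight_act_linear a).

Lemma weight_actD a b v :
  linfun (weight_act (a + b)) v =
  linfun (weight_act a) v + linfun (weight_act b) v.
Proof. by rewrite !lfunE; apply/rowP => k; rewrite !mxE !ffunE mulrDl. Qed.

Lemma weight_actM a b v :
  linfun (weight_act (a * b)) v =
  linfun (weight_act a) (linfun (weight_act b) v).
Proof. by rewrite !lfunE; apply/rowP => k; rewrite !mxE !ffunE mulrA. Qed.

Lemma weight_act1 v : linfun (weight_act 1) v = v.
Proof. by rewrite !lfunE; apply/rowP => k; rewrite !mxE !ffunE mul1r. Qed.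

Lemma weight_actK c v : linfun (weight_act (iota c)) v = c *: v.
Proof. by rewrite !lfunE; apply/rowP => k; rewrite !mxE !ffunE. Qed.

Definition weight_module : Mod :=
  @FdMod K A iota _ _ weight_actD weight_actM weight_act1 weight_actK.

End WeightModule.

Definition weight_line (i : 'I_n) : Mod := weight_module (fun _ : 'I_1 => i).

Lemma weight_lineE i (a : A) (v : weight_line i) :
  fdmod_act (weight_line i) a v = a i *: v.
Proof. by rewrite /= lfunE; apply/rowP => k; rewrite !mxE. Qed.

Definition weight_gen (i : 'I_n) : fdmod_space (weight_line i) := const_mx 1.

Definition weight_coord i (v : fdmod_space (weight_line i)) : K :=
  (v : 'rV_1) ord0 ord0.

Lemma weight_coordE i c (v : fdmod_space (weight_line i)) :
  weight_coord (c *: v) = c * weight_coord v.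
Proof. by rewrite /weight_coord mxE. Qed.

Lemma weight_coordD i (u v : fdmod_space (weight_line i)) :
  weight_coord (u + v) = weight_coord u + weight_coord v.
Proof. by rewrite /weight_coord mxE. Qed.

Lemma weight_coord_gen i : weight_coord (weight_gen i) = 1.
Proof. by rewrite /weight_coord mxE. Qed.

Lemma weight_gen_coord i (v : fdmod_space (weight_line i)) :
  v = weight_coord v *: weight_gen i.
Proof. by apply/rowP => k; rewrite !mxE mulr1 !ord1. Qed.

Lemma weight_line_brick : brick_family weight_line.
Proof.
split=> [i|i f|i j f ij].
- move=> /(congr1 (fun g : mor (weight_line i) (weight_line i) =>
    weight_coord (modapp g (weight_gen i)))).
  rewrite modapp_id modapp0 weight_coord_gen -(scale0r 0) weight_coordE mul0r.
  by move/eqP; rewrite oner_eq0.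
- exists (weight_coord (modapp f (weight_gen i))).
  apply: modapp_ext => v; rewrite (weight_gen_coord v) !modapp_linear.
  by rewrite modappZ modapp_id -weight_gen_coord.
- apply: modapp_ext => v; rewrite modapp0 (weight_gen_coord v) modapp_linear.
  (* The [i]-th primitive idempotent acts as one on the source and as zero on the target. *)
  pose a : A := [ffun k => (k == i)%:R].
  suff -> : modapp f (weight_gen i) = 0 by rewrite scaler0.
  have := modapp_act f a (weight_gen i); rewrite !weight_lineE !ffunE eqxx.
  have /negPf -> : j != i by rewrite eq_sym; exact/eqP.
  by rewrite scale1r scale0r.
Qed.

Lemma weight_module_decomposition m (j : 'I_m -> 'I_n) :
  exists s p, @decomposition K Mod n weight_line (weight_module j) m j s p.
Proof.
have ex k : {s : mor (weight_line (j k)) (weight_module j) |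
    forall v, modapp s v = weight_coord v *: delta_mx ord0 k}.
  apply: modhom_of => [c u v|a v].
    by rewrite weight_coordD weight_coordE scalerDl scalerA.
  rewrite weight_lineE weight_coordE /= lfunE; apply/rowP => l; rewrite !mxE.
  have [->|] := eqVneq l k; first by rewrite eqxx !mulr1.
  by rewrite andbF !mulr0.
have ey k : {p : mor (weight_module j) (weight_line (j k)) |
    forall v, modapp p v = (v : 'rV_m) ord0 k *: weight_gen (j k)}.
  apply: modhom_of => [c u v|a v].
    by rewrite !mxE scalerDl scalerA.
  by rewrite weight_lineE /= lfunE !mxE scalerA.
exists (fun k => sval (ex k)), (fun k => sval (ey k)); split=> [k|k l kl|].
- apply: modapp_ext => v; rewrite modapp_comp (svalP (ex k)) (svalP (ey k)).
  by rewrite !mxE !eqxx mulr1 modapp_id -weight_gen_coord.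
- apply: modapp_ext => v; rewrite modapp_comp (svalP (ex l)) (svalP (ey k)).
  have /negPf nkl : k != l by exact/eqP.
  by rewrite !mxE nkl andbF mulr0 scale0r modapp0.
- apply: modapp_ext => v; rewrite modapp_sum modapp_id [RHS]row_sum_delta.
  apply: eq_bigr => k _; rewrite modapp_comp (svalP (ex k)) (svalP (ey k)).
  by rewrite weight_coordE weight_coord_gen mulr1.
Qed.

(** * Weight decomposition of an arbitrary module *)

Section Weights.
Variable V : Mod.

Definition idem (i : 'I_n) : A := [ffun k => (k == i)%:R].

Definition weight_space i : {vspace V} := limg (fdmod_act V (idem i)).

Lemma weight_spaceE i v : v \in weight_space i -> fdmod_act V (idem i) v = v.
Proof.
move=> /memv_imgP[u _ ->]; rewrite -fdmod_actM; congr (fdmod_act V _ u).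
by apply/ffunP => k; rewrite !ffunE -natrM mulnb andbb.
Qed.

Lemma weight_space_act i v a : v \in weight_space i ->
  fdmod_act V a v = a i *: v.
Proof.
move=> vi; rewrite -{1}(weight_spaceE vi) -fdmod_actM.
have -> : a * idem i = iota (a i) * idem i.
  apply/ffunP => k; rewrite !ffunE; case: eqP => [->//|_].
  by rewrite !mulr0.
by rewrite fdmod_actM weight_spaceE// fdmod_actK.
Qed.

Lemma idem_act i a v :
  fdmod_act V (idem i) (fdmod_act V a v) = a i *: fdmod_act V (idem i) v.
Proof.
rewrite -(@weight_space_act i)// ?memv_img ?memvf// -!fdmod_actM.
by congr (fdmod_act V _ v); apply/ffunP => k; rewrite !ffunE mulrC.
Qed.

Lemma sum_idem_act v : \sum_i fdmod_act V (idem i) v = v.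
Proof.
have act0 : fdmod_act V 0 v = 0.
  by apply: (addrI (fdmod_act V 0 v)); rewrite -fdmod_actD !addr0.
rewrite -(big_morph (fun a : A => fdmod_act V a v)
  (fun a b => fdmod_actD a b v) act0).
rewrite -[RHS]fdmod_act1; congr (fdmod_act V _ v).
apply/ffunP => k; rewrite sum_ffunE ffunE (bigD1 k)//= ffunE eqxx.
by rewrite big1 ?addr0// => i ik; rewrite ffunE eq_sym (negPf ik).
Qed.

Notation I := {i : 'I_n & 'I_(\dim (weight_space i))}.

(** The primitive idempotents split [V] into weight spaces. Bases of these, indexed by pairs of a
    weight and a position, span the copies of simple modules, and the dual coordinates give the
    projections. *)
Lemma fdmod_decomposition :
  exists m (j : 'I_m -> 'I_n) s p, @decomposition K Mod n weight_line V m j s p.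
Proof.
pose w (q : I) : V := (vbasis (weight_space (tag q)))`_(tagged q).
have wi q : w q \in weight_space (tag q) by exact/vbasis_mem/memt_nth.
pose c (q : I) (v : V) : K := coord (vbasis (weight_space (tag q))) (tagged q)
  (fdmod_act V (idem (tag q)) v).
have cw q q' : c q (w q') = (q == q')%:R.
  rewrite /c (weight_space_act _ (wi q')) ffunE linearZ /=.
  have [<-|] := eqVneq q q'.
    by rewrite eqxx mul1r /w coord_free ?eqxx//; exact: basis_free (vbasisP _).
  case: q q' => i k [i' k'] /=; case: (i' =P i) => [ii'|_ _]; last first.
    by rewrite mul0r.
  subst i'; rewrite /w /= coord_free; last exact: basis_free (vbasisP _).
  by rewrite mul1r; case: (k' =P k) => [->|//]; rewrite eqxx.
have ex q : {s : mor (weight_line (tag q)) V |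
    forall v, modapp s v = weight_coord v *: w q}.
  apply: modhom_of => [b u v|a v].
    by rewrite weight_coordD weight_coordE scalerDl scalerA.
  rewrite weight_lineE weight_coordE linearZ /= (weight_space_act _ (wi q)).
  by rewrite !scalerA mulrC.
have ey q : {p : mor V (weight_line (tag q)) |
    forall v, modapp p v = c q v *: weight_gen (tag q)}.
  apply: modhom_of => [b u v|a v].
    by rewrite /c !linearP /= scalerDl scalerA.
  by rewrite weight_lineE /c idem_act linearZ scalerA.
exists #|{: I}|, (fun k => tag (enum_val k)).
exists (fun k => sval (ex (enum_val k))), (fun k => sval (ey (enum_val k))).
split=> [k|k l kl|].
- apply: modapp_ext => v.
  rewrite modapp_comp (svalP (ex _)) (svalP (ey _)) {1}/c !linearZ /=.
  rewrite -[coord _ _ _]/(c _ _) cw eqxx mulr1.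
  by rewrite modapp_id -weight_gen_coord.
- apply: modapp_ext => v.
  rewrite modapp_comp (svalP (ex _)) (svalP (ey _)) {1}/c !linearZ /=.
  rewrite -[coord _ _ _]/(c _ _) cw (inj_eq enum_val_inj).
  have /negPf -> : k != l by exact/eqP.
  by rewrite mulr0 scale0r modapp0.
- apply: modapp_ext => v; rewrite modapp_sum modapp_id.
  transitivity (\sum_(q : I) c q v *: w q).
    rewrite [RHS](reindex (@enum_val _ {: I})) /=; last first.
      by exists enum_rank => q _; rewrite ?enum_valK ?enum_rankK.
    apply: eq_bigr => k _.
    rewrite modapp_comp (svalP (ex _)) (svalP (ey _)).
    by rewrite weight_coordE weight_coord_gen mulr1.
  (* The sum over pairs is regrouped by weight; each inner sum expands one weight component in its
     basis. *)
  have := @sig_big_dep V 0 +%R _ _ (fun=> true) (fun _ _ => true)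
    (fun i (k : 'I_(\dim (weight_space i))) =>
       coord (vbasis (weight_space i)) k (fdmod_act V (idem i) v) *:
         (vbasis (weight_space i))`_k).
  move=> /= /esym e; apply: etrans (etrans e _); first exact: eq_bigl.
  rewrite -[RHS]sum_idem_act; apply: eq_bigr => i _.
  by rewrite -coord_vbasis// memv_img ?memvf.
Qed.

End Weights.

End PowerModules.

(** * The cyclic order of the circle *)

Section CyclicOrder.
Local Open Scope classical_set_scope.
Local Open Scope ring_scope.
Variable R : realType.
Implicit Types (r s t u : R) (x y z w : R * R).

Lemma circle_atDz t (k : int) : circle_at (t + k%:~R * (2 * pi)) = circle_at t.
Proof.
have circle_atDn (v : R) m : circle_at (v + m%:R * (2 * pi)) = circle_at v.
  have -> : m%:R * (2 * pi) = pi *+ 2 *+ m :> R.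
    by rewrite -[RHS]mulr_natl -[pi *+ 2]mulr_natl.
  by rewrite /circle_at (periodicn (@cosD2pi R)) (periodicn (@sinD2pi R)).
case: k => m; first exact: circle_atDn.
rewrite NegzE mulrNz mulNr -[in RHS](subrK (m.+1%:R * (2 * pi)) t).
by rewrite circle_atDn.
Qed.

(** For [s < t], half the difference lies strictly between [0] and [pi], where the sine is positive;
    equality of the points forces [cos (t - s) = 1], which makes that sine zero. *)
Lemma circle_at_le_inj s t :
  s <= t < s + 2 * pi -> circle_at s = circle_at t -> s = t.
Proof.
move=> /andP[st ts] [cst sst]; apply/eqP; apply: contraT => nst.
have {st nst} st : s < t by rewrite lt_neqAle nst.
pose u := (t - s) / 2.
have u0 : 0 < sin u by apply: sin_gt0_pi; rewrite /u; lra.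
have : cos (t - s) = 1 by rewrite cosB cst sst -!expr2 cos2Dsin2.
have -> : t - s = u *+ 2 by rewrite -mulr_natl /u; lra.
rewrite cos_mulr2n => e; have cd := cos2Dsin2 u.
have : sin u ^+ 2 = 0 by lra.
by move/eqP; rewrite sqrf_eq0 gt_eqF.
Qed.

Lemma circle_at_inj r s t : r <= s < r + 2 * pi -> r <= t < r + 2 * pi ->
  circle_at s = circle_at t -> s = t.
Proof.
move=> rs rt; have [st|/ltW ts] := leP s t.
- by apply: circle_at_le_inj; lra.
- by move=> e; apply/esym; apply: circle_at_le_inj (esym e); lra.
Qed.

(** An angle is found by [acos], its sign by the second coordinate, and a multiple of [2 * pi] moves
    it into the window. The free [r] lets later proofs cut the circle where convenient. *)
Lemma circle_atP (p : R * R) r : circle p ->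
  exists t, r <= t < r + 2 * pi /\ p = circle_at t.
Proof.
move=> p1; have [t0 ->] : exists t, p = circle_at t.
  have p1le : -1 <= p.1 <= 1.
    by rewrite -ler_norml -(expr_le1 (n := 2))// -normrX ger0_norm ?sqr_ge0//;
      rewrite -p1 lerDl sqr_ge0.
  have [/andP[c0 cpi] cE] := acos_def p1le.
  have : sin (acos p.1) ^+ 2 = p.2 ^+ 2.
    have := cos2Dsin2 (acos p.1); rewrite cE.
    by move: p1; rewrite /circle /= => p1; lra.
  move/eqP; rewrite eqf_sqr => /orP[/eqP e|/eqP e].
    by exists (acos p.1); rewrite /circle_at cE e; case: (p).
  exists (- acos p.1); rewrite /circle_at cosN sinN cE e opprK.
  by case: (p).
have pi2 : 0 < 2 * pi :> R by have := pi_gt0 R; lra.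
pose k := Num.floor ((t0 - r) / (2 * pi)).
exists (t0 + (- k)%:~R * (2 * pi)); split; last by rewrite circle_atDz.
have := floor_itv ((t0 - r) / (2 * pi)); rewrite -/k => /andP[].
rewrite ler_pdivlMr// ltr_pdivrMr// intrD mulrDl mul1r mulrNz mulNr.
by move=> k1 k2; apply/andP; split; lra.
Qed.

Lemma circle_at_circle t : circle (circle_at t).
Proof. exact: cos2Dsin2. Qed.

Lemma circle_at_eqz s t : circle_at s = circle_at t ->
  exists k : int, s = t + k%:~R * (2 * pi).
Proof.
move=> st; have pi2 : 0 < 2 * pi :> R by have := pi_gt0 R; lra.
pose k := Num.floor ((s - t) / (2 * pi)); exists k.
have := floor_itv ((s - t) / (2 * pi)); rewrite -/k => /andP[].
rewrite ler_pdivlMr// ltr_pdivrMr// intrD mulrDl mul1r => k1 k2.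
have : t = s - k%:~R * (2 * pi).
  apply: (@circle_at_inj t); [lra|lra|].
  by rewrite -mulNr -mulrNz circle_atDz.
lra.
Qed.

(** Fixing the angle of the first point turns the cyclic order into the order of real numbers in one
    window. *)
Lemma cycP r y z : cyc (circle_at r) y z <-> exists s t,
  [/\ r < s, s < t, t < r + 2 * pi, y = circle_at s & z = circle_at t].
Proof.
split=> [[r' [s [t [rs st tr [rr' -> ->]]]]]|[s [t [rs st tr -> ->]]]]; last first.
  by exists r, s, t.
have [k kE] := circle_at_eqz rr'.
exists (s + k%:~R * (2 * pi)), (t + k%:~R * (2 * pi)).
by rewrite !circle_atDz kE; split=> //; lra.
Qed.

Lemma cyc_circle x y z : cyc x y z -> [/\ circle x, circle y & circle z].
Proof.
by move=> [r [s [t [_ _ _ [-> -> ->]]]]]; split; exact: circle_at_circle.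
Qed.

Lemma cyc_rot x y z : cyc x y z -> cyc y z x.
Proof.
move=> [r [s [t [rs st tr [-> -> ->]]]]].
exists s, t, (r + 2 * pi); split=> //; first lra.
by split=> //; rewrite -[2 * pi]mul1r (circle_atDz _ 1).
Qed.

Lemma cyc_asym x y z : cyc x y z -> ~ cyc x z y.
Proof.
move=> xyz; have [/(circle_atP 0)[r [_ xr]] _ _] := cyc_circle xyz; subst x.
have /cycP[s [t [rs st tr yE zE]]] := xyz.
move=> /cycP[t' [s' [rt' ts' sr' zE' yE']]].
have e1 : s = s' by apply: (@circle_at_inj r); [lra|lra|congruence].
have e2 : t = t' by apply: (@circle_at_inj r); [lra|lra|congruence].
lra.
Qed.

Lemma cyc_trans x y z w : cyc x y z -> cyc x z w -> cyc x y w.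
Proof.
move=> xyz; have [/(circle_atP 0)[r [_ xr]] _ _] := cyc_circle xyz; subst x.
have /cycP[s [t [rs st tr yE zE]]] := xyz.
move=> /cycP[t' [q [rt' tq qr zE' wE]]].
have e2 : t = t' by apply: (@circle_at_inj r); [lra|lra|congruence].
by apply/cycP; exists s, q; split=> //; lra.
Qed.

Lemma cyc_total x y z : circle x -> circle y -> circle z ->
  x <> y -> x <> z -> y <> z -> cyc x y z \/ cyc x z y.
Proof.
move=> /(circle_atP 0)[r [_ ->]] /(circle_atP r)[s [rs ->]].
move=> /(circle_atP r)[t [rt ->]] xy xz yz.
have {}xy : r != s by apply/eqP => e; apply: xy; rewrite e.
have {}xz : r != t by apply/eqP => e; apply: xz; rewrite e.
have [st|ts|st] := ltgtP s t; last by case: yz; rewrite st.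
- left; apply/cycP; exists s, t; split=> //; last by lra.
  by rewrite lt_neqAle xy; lra.
- right; apply/cycP; exists t, s; split=> //; last by lra.
  by rewrite lt_neqAle xz; lra.
Qed.

Lemma cyc_neq x y z : cyc x y z -> [/\ x <> y, x <> z & y <> z].
Proof.
move=> xyz; have nyz : y <> z.
  by move=> yz; have := cyc_asym xyz; rewrite yz; apply; rewrite -{1}yz.
have irr (p q : R * R) : ~ cyc p p q.
  by move=> /cyc_rot/cyc_rot qpp; exact: (cyc_asym qpp qpp).
split=> // [xy|xz].
- by move: xyz; rewrite -xy => /irr.
- by move: xyz; rewrite -xz => /cyc_rot/cyc_rot/irr.
Qed.

Lemma cyc_trans2 x y z w : cyc x y z -> cyc x z w -> cyc y z w.
Proof.
move=> /cyc_rot/cyc_rot zxy /cyc_rot zwx.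
by have := cyc_trans zwx zxy; move/cyc_rot/cyc_rot.
Qed.

End CyclicOrder.

(** * Neighbours in an admissible set *)

Section AdmissibleSets.
Local Open Scope classical_set_scope.
Local Open Scope ring_scope.
Variables (R : realType) (Z : set (R * R)).
Hypothesis hZ : admissible Z.
Implicit Types (r s t : R) (x y z w p : R * R).

Lemma Z_circle z : Z z -> circle z.
Proof. by case: hZ => Zc _ _ _ _; exact: Zc. Qed.

Lemma circle_at_nbhs t (V : set (R * R)) : nbhs (circle_at t) V ->
  exists2 e, 0 < e & forall u, `|u - t| < e -> V (circle_at u).
Proof.
move=> tV; have /nbhs_ballP[e /= e0 eV] : nbhs t (fun u => V (circle_at u)).
  have := cvg_pair (@continuous_cos R t) (@continuous_sin R t).
  by move=> /(_ _ _ _ V tV).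
by exists e => // u ut; apply: eV; rewrite -ball_normE /= distrC.
Qed.

(** Accumulation in terms of angles, so that suprema and infima of reals yield limit points. *)
Definition cluster_angle t := forall e, 0 < e ->
  exists2 u, Z (circle_at u) & u != t /\ `|u - t| < e.

Lemma cluster_angle_limit t : cluster_angle t -> limit_points Z (circle_at t).
Proof.
move=> acc; split=> [B /circle_at_nbhs[e e0 eB]|Zt].
  by have [u Zu [_ ue]] := acc e e0; exists (circle_at u); split=> //; exact: eB.
have [_ /(_ _ Zt)[_ [V /circle_at_nbhs[e e0 eV] VZ]] _ _ _] := hZ.
have pi0 := pi_gt0 R.
(* Staying within [pi] of [t] ensures that distinct angles give distinct points. *)
have me0 : 0 < Num.min e pi by rewrite lt_min e0.
have [u Zu [ut]] := acc _ me0; rewrite lt_min => /andP[ue upi].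
have : [set circle_at t] (circle_at u) by rewrite -VZ; split=> //; exact: eV.
move=> /= eq_ut; case/eqP: ut.
apply: (@circle_at_inj _ (t - pi)); [|lra|exact: eq_ut].
by move: upi; rewrite ltr_norml; lra.
Qed.

Lemma limit_left s t : limit_points Z (circle_at t) -> s < t ->
  exists2 u, Z (circle_at u) & s < u < t.
Proof.
move=> Lt st; have pi0 := pi_gt0 R.
(* The lower bound is raised to within [pi] of [t], so that a single window contains both angles. *)
have [s' ss' /andP[s't ts']] : exists2 s', s <= s' & s' < t < s' + 2 * pi.
  exists (Num.max s (t - pi)); rewrite ?le_max ?lexx// gt_max st.
  by case: (leP s (t - pi)); lra.
have s'n : circle_at s' <> circle_at t.
  by move=> /circle_at_le_inj; lra.
have [_ _ _ _ /(_ _ Lt _ (circle_at_circle s') s'n)] := hZ.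
move=> [_ [z Zz /cycP[u [v [s'u uv vs' zE vE]]]]].
have vt : t = v by apply: (@circle_at_inj _ s'); [lra|lra|].
by exists u; [rewrite -zE|lra].
Qed.

Lemma limit_right s t : limit_points Z (circle_at t) -> t < s ->
  exists2 u, Z (circle_at u) & t < u < s.
Proof.
move=> Lt ts; have pi0 := pi_gt0 R.
have [s' ss' /andP[s't ts']] : exists2 s', s' <= s & t < s' < t + 2 * pi.
  exists (Num.min s (t + pi)); rewrite ?ge_min ?lexx// lt_min ts.
  by case: (leP s (t + pi)); lra.
have s'n : circle_at s' <> circle_at t.
  by move=> /esym/circle_at_le_inj; lra.
have [_ _ _ _ /(_ _ Lt _ (circle_at_circle s') s'n)] := hZ.
move=> [[z Zz /cycP[u [v [s'u uv vs' zE vE]]]] _].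
have vt : s' = v by apply: (@circle_at_inj _ t); [lra|lra|].
by exists u; [rewrite -zE|lra].
Qed.

(** If the infimum of the later angles were not attained, it would be a limit point, and
    two-sidedness would put a point of [Z] strictly between [t] and it. *)
Lemma next_angle t : Z (circle_at t) -> exists m, [/\ t < m, Z (circle_at m) &
  forall u, Z (circle_at u) -> t < u -> m <= u].
Proof.
move=> Zt; pose E := [set u | Z (circle_at u) /\ t < u].
have pi0 := pi_gt0 R.
have infE : has_inf E.
  split; last by exists t => u [_ /ltW].
  (* The point itself returns after a full turn, so there are later angles. *)
  exists (t + 2 * pi); split; last lra.
  by have := circle_atDz t 1; rewrite mul1r => ->.
have infle u : E u -> inf E <= u by move=> Eu; exact: ge_inf (proj2 infE) _ Eu.
suff Em : E (inf E).
  by exists (inf E); case: Em => Zm tm; split=> // u Zu tu; exact: infle.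
apply: contrapT => nE.
have Lm : limit_points Z (circle_at (inf E)).
  apply: cluster_angle_limit => e e0.
  have [u Eu ue] := inf_adherent e0 infE; exists u; first by case: Eu.
  have ne : u != inf E by apply/eqP => uE; apply: nE; rewrite -uE.
  by split=> //; have iu := infle u Eu; rewrite ger0_norm; lra.
have tm : t < inf E.
  rewrite lt_neqAle; apply/andP; split.
    by apply/eqP => tE; case: Lm => _; rewrite -tE.
  by apply: lb_le_inf; [case: infE|move=> u [_ /ltW]].
have [u Zu /andP[tu um]] := limit_left Lm tm.
by have := infle u (conj Zu tu); lra.
Qed.

Lemma prev_angle t : Z (circle_at t) -> exists m, [/\ m < t, Z (circle_at m) &
  forall u, Z (circle_at u) -> u < t -> u <= m].
Proof.
move=> Zt; pose E := [set u | Z (circle_at u) /\ u < t].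
have pi0 := pi_gt0 R.
have supE : has_sup E.
  split; last by exists t => u [_ /ltW].
  exists (t - 2 * pi); split; last lra.
  by have := circle_atDz t (-1); rewrite mulN1r => ->.
have supge u : E u -> u <= sup E by move=> Eu; exact: ub_le_sup (proj2 supE) _ Eu.
suff Em : E (sup E).
  by exists (sup E); case: Em => Zm tm; split=> // u Zu tu; exact: supge.
apply: contrapT => nE.
have Lm : limit_points Z (circle_at (sup E)).
  apply: cluster_angle_limit => e e0.
  have [u Eu ue] := sup_adherent e0 supE; exists u; first by case: Eu.
  have ne : u != sup E by apply/eqP => uE; apply: nE; rewrite -uE.
  by split=> //; have iu := supge u Eu; rewrite ler0_norm; lra.
have tm : sup E < t.
  rewrite lt_neqAle; apply/andP; split.
    by apply/eqP => tE; case: Lm => _; rewrite tE.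
  by apply: ge_sup; [case: supE|move=> u [_ /ltW]].
have [u Zu /andP[tu um]] := limit_right Lm tm.
by have := supge u (conj Zu um); lra.
Qed.

Lemma another_Z z : Z z -> exists2 w, Z w & w <> z.
Proof.
move=> Zz; apply: contrapT => no; have [_ _ inf _ _] := hZ; apply: inf.
apply: (@sub_finite_set _ _ [set z]); last exact: finite_set1.
by move=> w Zw /=; apply: contrapT => wz; apply: no; exists w.
Qed.

(** [zsucc] is an [xget], so some point must first be shown to satisfy its predicate. The next angle
    provides one, and a second point of [Z] keeps it short of a full turn. *)
Lemma zsuccP z : Z z -> [/\ Z (zsucc Z z), zsucc Z z <> z
  & forall u, Z u -> ~ cyc z u (zsucc Z z)].
Proof.
move=> Zz; pose P w := [/\ Z w, w <> z & forall u, Z u -> ~ cyc z u w].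
suff : P (zsucc Z z) by [].
have [t [_ zt]] := circle_atP 0 (Z_circle Zz).
have [m [tm Zm mmin]] : exists m, [/\ t < m, Z (circle_at m) &
    forall u, Z (circle_at u) -> t < u -> m <= u] by apply: next_angle; rewrite -zt.
have mt : m < t + 2 * pi.
  have [w Zw wz] := another_Z Zz.
  have [s [ts ws]] := circle_atP t (Z_circle Zw).
  have nts : t != s by apply/eqP => e; apply: wz; rewrite zt e.
  have := mmin s; rewrite -ws => /(_ Zw); rewrite lt_neqAle nts; lra.
apply: xgetPex; exists (circle_at m); split=> //.
  by rewrite zt => /esym/circle_at_le_inj; lra.
move=> u Zu; rewrite zt => /cycP[s [v [ts sv vt us mv]]].
have e : m = v by apply: (@circle_at_inj _ t); [lra|lra|].
by have := mmin s; rewrite -us => /(_ Zu ts); lra.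
Qed.

Lemma zpredP z : Z z -> [/\ Z (zpred Z z), zpred Z z <> z
  & forall u, Z u -> ~ cyc (zpred Z z) u z].
Proof.
move=> Zz; pose P w := [/\ Z w, w <> z & forall u, Z u -> ~ cyc w u z].
suff : P (zpred Z z) by [].
have [t [_ zt]] := circle_atP 0 (Z_circle Zz).
have [m [mt Zm mmax]] : exists m, [/\ m < t, Z (circle_at m) &
    forall u, Z (circle_at u) -> u < t -> u <= m] by apply: prev_angle; rewrite -zt.
have tm : t < m + 2 * pi.
  have [w Zw wz] := another_Z Zz.
  have [s [ts ws]] := circle_atP (t - 2 * pi) (Z_circle Zw).
  have nts : t - 2 * pi != s.
    apply/eqP => e; apply: wz; rewrite zt ws -e.
    by have := circle_atDz t (-1); rewrite mulN1r.
  have := mmax s; rewrite -ws => /(_ Zw).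
  have : t - 2 * pi < s by rewrite lt_neqAle nts; lra.
  lra.
apply: xgetPex; exists (circle_at m); split=> //.
  by rewrite zt => /circle_at_le_inj; lra.
move=> u Zu; rewrite zt => /cycP[s [v [ms sv vm us tv]]].
have e : t = v by apply: (@circle_at_inj _ m); [lra|lra|].
by have := mmax s; rewrite -us => /(_ Zu); lra.
Qed.

Lemma Z_total x y z : Z x -> Z y -> Z z -> x <> y -> x <> z -> y <> z ->
  cyc x y z \/ cyc x z y.
Proof. by move=> /Z_circle ? /Z_circle ? /Z_circle ?; exact: cyc_total. Qed.

Lemma zsucc_uniq z w : Z z -> Z w -> w <> z -> (forall u, Z u -> ~ cyc z u w) ->
  zsucc Z z = w.
Proof.
move=> Zz Zw wz no; have [Zs sz nos] := zsuccP Zz.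
apply: contrapT => sw.
have [/no|/nos] := Z_total Zz Zs Zw (nesym sz) (nesym wz) sw; exact.
Qed.

Lemma zpred_uniq z w : Z z -> Z w -> w <> z -> (forall u, Z u -> ~ cyc w u z) ->
  zpred Z z = w.
Proof.
move=> Zz Zw wz no; have [Zs sz nos] := zpredP Zz.
apply: contrapT => sw.
have [zpw|zwp] := Z_total Zz Zs Zw (nesym sz) (nesym wz) sw.
- exact: nos Zw (cyc_rot zpw).
- exact: no Zs (cyc_rot zwp).
Qed.

Lemma zpredK z : Z z -> zsucc Z (zpred Z z) = z.
Proof.
by move=> Zz; have [Zp pz nop] := zpredP Zz; apply: zsucc_uniq => //; exact/nesym.
Qed.

Lemma zsuccK z : Z z -> zpred Z (zsucc Z z) = z.
Proof.
by move=> Zz; have [Zp pz nop] := zsuccP Zz; apply: zpred_uniq => //; exact/nesym.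
Qed.

Lemma zsucc_Z z : Z z -> Z (zsucc Z z). Proof. by case/zsuccP. Qed.

Lemma zpred_Z z : Z z -> Z (zpred Z z). Proof. by case/zpredP. Qed.

Lemma zsucc_inj z w : Z z -> Z w -> zsucc Z z = zsucc Z w -> z = w.
Proof. by move=> Zz Zw e; rewrite -(zsuccK Zz) e zsuccK. Qed.

Lemma zsucc_cyc z u : Z z -> Z u -> u <> z -> u <> zsucc Z z ->
  cyc z (zsucc Z z) u.
Proof.
move=> Zz Zu uz us; have [Zs sz nos] := zsuccP Zz.
have [//|/(nos _ Zu)//] := Z_total Zz Zs Zu (nesym sz) (nesym uz) (nesym us).
Qed.

(** By two-sidedness, points of [Z] would approach [p] from the side of [z] and come before the
    successor. *)
Lemma no_limit_zsucc z p : Z z -> limit_points Z p -> ~ cyc z p (zsucc Z z).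
Proof.
move=> Zz Lp zps; have [Zs sz nos] := zsuccP Zz.
have zp : z <> p by move=> e; case: Lp; rewrite -e.
have [_ _ _ _ /(_ _ Lp _ (Z_circle Zz) zp)[_ [u Zu zup]]] := hZ.
exact: nos Zu (cyc_trans zup zps).
Qed.

End AdmissibleSets.

(** * Gaps between limit points *)

Section Gaps.
Local Open Scope classical_set_scope.
Local Open Scope ring_scope.
Variables (R : realType) (Z : set (R * R)) (hZ : admissible Z).
Variables (n : nat) (hn : (2 <= n)%N) (a : 'I_n -> R * R).
Hypothesis ha : limit_point_enumeration Z a.
Notation point := (R * R)%type.
Notation s := (zsucc Z).

Lemma a_limit k : limit_points Z (a k).
Proof. by have [<- _ _] := ha; exists k. Qed.

Lemma a_notin k : ~ Z (a k).
Proof. by case: (a_limit k). Qed.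

Lemma limit_a p : limit_points Z p -> exists k, p = a k.
Proof. by have [<- _ _] := ha; move=> [k _ <-]; exists k. Qed.

Lemma closure_cases p : closure Z p -> Z p \/ exists k, p = a k.
Proof.
by move=> clp; have [Zp|nZp] := pselect (Z p); [left|right; exact: limit_a].
Qed.

Lemma a_inj i j : a i = a j -> i = j.
Proof. by have [_ inj _] := ha; exact: inj. Qed.

Lemma ordS_neq (i : 'I_n) : ordS i <> i.
Proof.
move=> /(congr1 val) /=; have := ltn_ord i; rewrite leq_eqVlt => /orP[/eqP e|lt].
  by rewrite e modnn => e0; move: hn; rewrite -e -e0.
by rewrite modn_small// => /eqP; rewrite eqn_leq ltnn.
Qed.

Lemma a_neq_next i : a i <> a (ordS i).
Proof. by move=> /a_inj/esym/ordS_neq. Qed.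

Lemma Z_inhabited : exists z, Z z.
Proof.
have [_ _ inf _ _] := hZ; apply: contrapT => no; apply: inf.
by have -> : Z = set0 by apply/seteqP; split=> // z Zz; apply: no; exists z.
Qed.

Lemma a_circle k : circle (a k).
Proof.
have [z Zz] := Z_inhabited.
have za : z <> a k by move=> e; apply: (@a_notin k); rewrite -e.
have [_ _ _ _ /(_ _ (a_limit k) _ (Z_circle hZ Zz) za)] := hZ.
by move=> [[w _ /cyc_circle[]]].
Qed.

Lemma a_gap i k : ~ cyc (a i) (a k) (a (ordS i)).
Proof.
have [_ _ mono] := ha; move=> c.
have [ik _ ki] := cyc_neq c.
have {}ik : (i : nat) != k by apply/eqP => /val_inj e; apply: ik; rewrite e.
have {}ki : (k : nat) != ordS i by apply/eqP => /val_inj e; apply: ki; rewrite e.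
(* The last index is separate, as its cyclic successor is [0]; the increasing triple is then
   [0 < k < i]. *)
have := ltn_ord i; rewrite leq_eqVlt => /orP[/eqP e|lt].
  have S0 : ordS i = 0%N :> nat by rewrite /= e modnn.
  rewrite S0 in ki.
  have kn := ltn_ord k; have ki' : (k < i)%N by rewrite ltn_neqAle eq_sym ik -ltnS e.
  have k0 : (ordS i < k)%N by rewrite S0 lt0n.
  have := mono _ _ _ (introT andP (conj k0 ki')) => c'.
  exact: (cyc_asym c (cyc_rot (cyc_rot c'))).
have Si : ordS i = i.+1 :> nat by rewrite /= modn_small.
rewrite Si in ki.
have [ki'|ik'] := ltnP k i.
  have := mono k i (ordS i); rewrite ki' Si ltnSn => /(_ isT) c'.
  exact: (cyc_asym c (cyc_rot c')).
have := mono i (ordS i) k; rewrite Si ltnSn => /(_ _) c'.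
apply: (cyc_asym c); apply: c'.
by rewrite ltn_neqAle eq_sym ki ltn_neqAle ik.
Qed.

Definition gap i z := Z z /\ cyc (a i) z (a (ordS i)).

Lemma gap_Z i z : gap i z -> Z z. Proof. by case. Qed.

Lemma gap_inhabited i : exists z, gap i z.
Proof.
have [_ _ _ _ /(_ _ (a_limit i) _ (a_circle (ordS i)) (nesym (@a_neq_next i)))] := hZ.
by move=> [[z Zz zc] _]; exists z.
Qed.

Lemma gap_exists z : Z z -> exists i, gap i z.
Proof.
move=> Zz; have [t [_ zt]] := circle_atP 0 (Z_circle hZ Zz); subst z.
have pi0 := pi_gt0 R.
have ex k : {u | t - 2 * pi < u < t & a k = circle_at u}.
  apply: cid2; have [u [tu uE]] := circle_atP (t - 2 * pi) (a_circle k).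
  exists u => //.
  have ne : t - 2 * pi != u.
    apply/eqP => e; apply: (@a_notin k); rewrite uE -e.
    by have := circle_atDz t (-1); rewrite mulN1r => ->.
  have : t - 2 * pi < u by rewrite lt_neqAle ne; lra.
  lra.
pose u k := s2val (ex k).
have i0 : 'I_n by exact: Ordinal hn.
(* [a i] is the last limit point before [z]; the next one has a smaller angle in this window and so
   follows [z] one turn later. *)
have [i _ imax] := @arg_maxP _ _ _ i0 xpredT u isT.
exists i; split=> //.
have := imax (ordS i) isT; rewrite /u.
case: (ex i) (ex (ordS i)) => [v vt av] [v' v't av'] /= v'v.
have ne : v' != v.
  by apply/eqP => e; apply: (@a_neq_next i); rewrite av av' e.
have {v'v ne} v'v : v' < v by rewrite lt_neqAle ne.
case/andP: vt => _ vt; case/andP: v't => v't _.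
rewrite av; apply/cycP; exists t, (v' + 2 * pi); split=> //.
- by rewrite -ltrBlDr.
- by rewrite ltrD2r.
- by rewrite av'; have := circle_atDz v' 1; rewrite mul1r.
Qed.

(** No limit point lies inside the [i]-th gap, so [a i] comes between [a j] and [z]; this
    contradicts the same property of the [j]-th gap. *)
Lemma gap_uniq i j z : gap i z -> gap j z -> i = j.
Proof.
move=> [Zz iz] [_ jz]; apply: contrapT => ij.
have aij : a i <> a j by move=> /a_inj.
have jiz : cyc (a j) (a i) z.
  apply/cyc_rot/cyc_rot; have [<-|nji] := pselect (a (ordS i) = a j) => //.
  have [|c] := cyc_total (a_circle i) (a_circle j) (a_circle (ordS i)) aij
    (@a_neq_next i) (nesym nji).
    by move=> /a_gap.
  exact: cyc_trans iz c.
have [e|ne] := pselect (a (ordS j) = a i).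
  by move: jz; rewrite e => /cyc_asym; apply.
exact: (@a_gap j i) (cyc_trans jiz jz).
Qed.

Lemma gap_zsucc i z : gap i z -> gap i (s z).
Proof.
move=> [Zz iz]; have [Zs sz nos] := zsuccP hZ Zz; split=> //.
have nz k : z <> a k by move=> e; apply: (@a_notin k); rewrite -e.
have ns k : s z <> a k by move=> e; apply: (@a_notin k); rewrite -e.
have [|c] := cyc_total (Z_circle hZ Zz) (a_circle (ordS i)) (Z_circle hZ Zs)
  (nz _) (nesym sz) (nesym (@ns _)).
  by move=> /(no_limit_zsucc hZ Zz (a_limit _)).
exact: cyc_rot (cyc_trans (cyc_rot (cyc_rot iz)) (cyc_rot (cyc_rot c))).
Qed.

Lemma gap_zsucc_cyc i z : gap i z -> cyc (a i) z (s z).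
Proof.
move=> [Zz iz]; have [Zs sz nos] := zsuccP hZ Zz.
have nz k : z <> a k by move=> e; apply: (@a_notin k); rewrite -e.
have ns k : s z <> a k by move=> e; apply: (@a_notin k); rewrite -e.
have [c|] := cyc_total (Z_circle hZ Zz) (Z_circle hZ Zs) (a_circle i)
  (nesym sz) (nz _) (@ns _); first exact/cyc_rot/cyc_rot.
by move=> /(no_limit_zsucc hZ Zz (a_limit _)).
Qed.

Lemma gap_zpred i z : gap i z -> gap i (zpred Z z).
Proof.
move=> iz; have Zz := gap_Z iz.
have [j jz] := gap_exists (zpred_Z hZ Zz).
have := gap_zsucc jz; rewrite (zpredK hZ Zz) => jz'.
by rewrite (gap_uniq iz jz').
Qed.

Lemma gap_iter i z k : gap i z -> gap i (iter k s z).
Proof. by move=> iz; elim: k => //= k; exact: gap_zsucc. Qed.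

Lemma gap_iter_cyc i z k : gap i z -> cyc (a i) z (iter k.+1 s z).
Proof.
move=> iz; elim: k => [|k IH]; first exact: gap_zsucc_cyc.
exact: cyc_trans IH (gap_zsucc_cyc (gap_iter k.+1 iz)).
Qed.

Lemma iter_zsucc_neq z k : Z z -> iter k.+1 s z <> z.
Proof.
move=> /gap_exists[i iz] e; have := gap_iter_cyc k iz.
by rewrite e => /cyc_neq[_ _].
Qed.

(** Otherwise all iterated successors of [y] stay before [w], and the supremum of their angles is a
    limit point strictly inside the gap, against [a_gap]. *)
Lemma gap_reach i y w : gap i y -> gap i w -> y = w \/ cyc (a i) y w ->
  exists k, iter k s y = w.
Proof.
move=> iy iw yw; apply: contrapT => no.
have {}no k : iter k s y <> w by move=> e; apply: no; exists k.
have {yw} yw : cyc (a i) y w by case: yw => // e; case: (no 0%N).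
have below k : cyc (a i) (iter k s y) w.
  elim: k => //= k IH.
  have iyk := gap_iter k iy; have [Zs sz nos] := zsuccP hZ (gap_Z iyk).
  have ns j : s (iter k s y) <> a j by move=> e; apply: (@a_notin j); rewrite -e.
  have nw j : w <> a j by move=> e; apply: (@a_notin j); rewrite -e; exact: gap_Z iw.
  have [//|c] := cyc_total (a_circle i) (Z_circle hZ Zs) (Z_circle hZ (gap_Z iw))
    (nesym (@ns i)) (nesym (@nw i)) (no k.+1).
  by have := cyc_trans2 IH c => /(nos _ (gap_Z iw)).
have [r [_ ar]] := circle_atP 0 (a_circle i).
have [v [t [rv vt tr yv wt]]] : exists v t, [/\ r < v, v < t, t < r + 2 * pi,
    y = circle_at v & w = circle_at t] by apply/cycP; rewrite -ar.
pose E := [set u | r < u < t /\ exists k, circle_at u = iter k s y].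
have Ev : E v by split; [lra|exists 0%N].
have supE : has_sup E by split; [exists v|exists t => u [/andP[_ /ltW]]].
(* [E] has no largest element, so its supremum is approached by angles different from it. *)
have Enext u : E u -> exists2 u', E u' & u < u'.
  move=> [rut [k uk]].
  have [u1 [u2 [ru1 u12 u2r u1E u2E]]] : exists u1 u2, [/\ r < u1, u1 < u2,
      u2 < r + 2 * pi, iter k s y = circle_at u1 & iter k.+1 s y = circle_at u2].
    by apply/cycP; rewrite -ar; exact/gap_zsucc_cyc/gap_iter.
  have [u3 [u4 [ru3 u34 u4r u3E u4E]]] : exists u1 u2, [/\ r < u1, u1 < u2,
      u2 < r + 2 * pi, iter k.+1 s y = circle_at u1 & w = circle_at u2].
    by apply/cycP; rewrite -ar; exact: below.
  have e1 : u = u1 by apply: (@circle_at_inj _ r); [lra|lra|congruence].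
  have e2 : u2 = u3 by apply: (@circle_at_inj _ r); [lra|lra|congruence].
  have e3 : t = u4 by apply: (@circle_at_inj _ r); [lra|lra|congruence].
  by exists u2; [split; [lra|exists k.+1]|lra].
have supge u : E u -> u <= sup E by move=> Eu; exact: ub_le_sup (proj2 supE) _ Eu.
have Lm : limit_points Z (circle_at (sup E)).
  apply: cluster_angle_limit => // e e0.
  have [u Eu ue] := sup_adherent e0 supE; exists u.
    by case: Eu => _ [k ->]; exact: gap_Z (gap_iter k iy).
  have [u' Eu' uu'] := Enext u Eu; have u's := supge u' Eu'.
  by split; [rewrite lt_eqF//; lra|rewrite ltr0_norm; lra].
have vm := supge v Ev.
have mt : sup E < t.
  rewrite lt_neqAle; apply/andP; split.
    by apply/eqP => e; case: Lm => _; rewrite e -wt => /(_ (gap_Z iw)).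
  by apply: ge_sup; [case: supE|move=> u [/andP[_ /ltW]]].
have [l lE] := limit_a Lm; apply: (@a_gap i l); rewrite -lE.
apply: (@cyc_trans _ _ _ w); last by case: iw.
by rewrite ar; apply/cycP; exists (sup E), t; split=> //; lra.
Qed.

End Gaps.

(** * Arcs and crossings *)

Section Crossings.
Local Open Scope classical_set_scope.
Variables (R : realType) (Z : set (R * R)) (hZ : admissible Z).
Variables (n : nat) (hn : (2 <= n)%N) (a : 'I_n -> R * R).
Hypothesis ha : limit_point_enumeration Z a.
Notation s := (zsucc Z).
Notation zs_neq k := (iter_zsucc_neq hZ hn ha (k := k)).

Lemma set2_eq (T : Type) (x y u v : T) : [set x; y] = [set u; v] ->
  (x = u /\ y = v) \/ (x = v /\ y = u).
Proof.
move=> e.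
have : [set u; v] x by rewrite -e; left.
have : [set u; v] y by rewrite -e; right.
have : [set x; y] u by rewrite e; left.
have : [set x; y] v by rewrite e; right.
by rewrite /=; intuition congruence.
Qed.

Lemma is_arcP y0 y1 : is_arc Z [set y0; y1] <->
  [/\ Z y0, Z y1, y1 <> y0, y1 <> s y0 & y0 <> s y1].
Proof.
split=> [[z0 [z1 [e Z0 Z1 [n1 n2 n3]]]]|[Z0 Z1 n1 n2 n3]]; last first.
  exists y0, y1; split=> //; split=> // e; apply: n3.
  by rewrite e (zpredK hZ).
have n4 : z0 <> s z1 by move=> z01; apply: n1; rewrite z01 (zsuccK hZ).
by have [[-> ->]|[-> ->]] := set2_eq e; split=> //; exact/nesym.
Qed.

Lemma is_arc_image_zsucc A : is_arc Z A -> is_arc Z (s @` A).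
Proof.
move=> Aarc; have [y0 [y1 [e _ _ _]]] := Aarc; subst A.
move/is_arcP: Aarc => [Z0 Z1 n1 n2 n3]; rewrite image_setU !image_set1.
have := zsucc_Z hZ Z0; have := zsucc_Z hZ Z1 => sZ1 sZ0.
by apply/is_arcP; split=> // /(zsucc_inj hZ); auto.
Qed.

Lemma image_zpredK A : A `<=` Z -> s @` (zpred Z @` A) = A.
Proof.
move=> AZ; rewrite image_comp; apply/seteqP; split=> [_ [z Az <-]|z Az] /=.
  by rewrite (zpredK hZ)//; exact: AZ.
by exists z => //=; rewrite (zpredK hZ)//; exact: AZ.
Qed.

Lemma image_zsuccK A : A `<=` Z -> zpred Z @` (s @` A) = A.
Proof.
move=> AZ; rewrite image_comp; apply/seteqP; split=> [_ [z Az <-]|z Az] /=.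
  by rewrite (zsuccK hZ)//; exact: AZ.
by exists z => //=; rewrite (zsuccK hZ)//; exact: AZ.
Qed.

Lemma is_arc_sub A : is_arc Z A -> A `<=` Z.
Proof. by move=> [y0 [y1 [-> Z0 Z1 _]]] z [->|->]. Qed.

Lemma is_arc_image_zpred A : is_arc Z A -> is_arc Z (zpred Z @` A).
Proof.
move=> Aarc; have [y0 [y1 [e _ _ _]]] := Aarc; subst A.
move/is_arcP: Aarc => [Z0 Z1 n1 n2 n3]; rewrite image_setU !image_set1.
have pZ0 := zpred_Z hZ Z0; have pZ1 := zpred_Z hZ Z1.
have e0 := zpredK hZ Z0; have e1 := zpredK hZ Z1.
by apply/is_arcP; split=> //; congruence.
Qed.

Lemma cross_sym (A B : set (R * R)) : cross A B -> cross B A.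
Proof.
move=> [y0 [y1 [z0 [z1 [-> ->]]]]] [[c1 c2 c3 c4]|[c1 c2 c3 c4]].
- by exists z0, z1, y1, y0; split=> //; [rewrite setUC|left].
- by exists z1, z0, y1, y0; split=> //; [rewrite setUC|rewrite setUC|left].
Qed.

Lemma is_arc_gap2 z : Z z -> is_arc Z [set z; s (s z)].
Proof.
move=> Zz; apply/is_arcP; split=> //; first by do 2!apply: (zsucc_Z hZ).
- exact: (zs_neq 1 Zz).
- exact: (zs_neq 0 (zsucc_Z hZ Zz)).
- exact: (nesym (zs_neq 2 Zz)).
Qed.

Lemma is_arc_gap3 z : Z z -> is_arc Z [set z; s (s (s z))].
Proof.
move=> Zz; apply/is_arcP; split=> //; first by do 3!apply: (zsucc_Z hZ).
- exact: (zs_neq 2 Zz).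
- exact: (zs_neq 1 (zsucc_Z hZ Zz)).
- exact: (nesym (zs_neq 3 Zz)).
Qed.

Lemma zsucc2_cyc z u : Z z -> Z u -> u <> z -> u <> s z -> u <> s (s z) ->
  cyc z (s (s z)) u.
Proof.
move=> Zz Zu n0 n1 n2; have c1 := zsucc_cyc hZ Zz Zu n0 n1.
have c2 := zsucc_cyc hZ (zsucc_Z hZ Zz) Zu n1 n2.
exact: cyc_rot (cyc_trans (cyc_rot (cyc_rot c1)) (cyc_rot (cyc_rot c2))).
Qed.

Lemma cross_gap2 z u : Z z -> Z u -> u <> z -> u <> s z -> u <> s (s z) ->
  cross [set s z; u] [set z; s (s z)].
Proof.
move=> Zz Zu n0 n1 n2; exists (s z), u, (s (s z)), z; split=> //.
  by rewrite setUC.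
left; split.
- exact: zsucc_cyc (zsucc_Z hZ Zz) Zu n1 n2.
- exact/cyc_rot/zsucc2_cyc.
- exact/cyc_rot/cyc_rot/zsucc_cyc.
- apply: zsucc_cyc => //; first by do 2!apply: (zsucc_Z hZ).
    exact: (zs_neq 1 Zz).
  exact: (zs_neq 0 (zsucc_Z hZ Zz)).
Qed.

(** A crossing arc has an endpoint strictly between [z] and [s (s z)], where [s z] is the only point
    of [Z]. *)
Lemma cross_gap2_mem A z : Z z -> is_arc Z A -> cross A [set z; s (s z)] ->
  A (s z).
Proof.
move=> Zz Aarc [y0 [y1 [z0 [z1 [eA eB c]]]]].
have [Z0 Z1] : Z y0 /\ Z y1.
  by split; apply: (is_arc_sub Aarc); rewrite eA; [left|right].
have mid u : Z u -> cyc z u (s (s z)) -> u = s z.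
  move=> Zu zu; apply: contrapT => us.
  have [uz _ uss] := cyc_neq zu.
  exact: (cyc_asym zu (zsucc2_cyc Zz Zu (nesym uz) us uss)).
case: c => -[c1 c2 c3 c4]; have [[e0 e1]|[e0 e1]] := set2_eq eB;
  subst z0 z1; rewrite eA.
- by right; rewrite (mid y1).
- by left; rewrite (mid y0).
- by left; rewrite (mid y0).
- by right; rewrite (mid y1).
Qed.

(** Neither endpoint is among the next two successors of the other, so moving both two steps ahead
    passes neither of them and the four points alternate. *)
Lemma cross_shift2 y0 y1 : is_arc Z [set y0; y1] -> y1 <> s (s y0) ->
  y0 <> s (s y1) -> cross [set y0; y1] [set s (s y0); s (s y1)].
Proof.
move=> /is_arcP[Z0 Z1 n1 n2 n3] m1 m2.
have inj := @zsucc_inj _ _ hZ.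
have sZ0 := zsucc_Z hZ Z0; have sZ1 := zsucc_Z hZ Z1.
have ssZ0 := zsucc_Z hZ sZ0; have ssZ1 := zsucc_Z hZ sZ1.
exists y0, y1, (s (s y0)), (s (s y1)); split=> //; left; split.
- exact: zsucc2_cyc.
- apply/cyc_rot/cyc_rot/zsucc2_cyc => //; [exact/nesym| |].
  + by move=> /(inj _ _ sZ0 Z1)/esym.
  + by move=> /(inj _ _ sZ0 sZ1)/(inj _ _ Z0 Z1)/esym.
- by apply: zsucc2_cyc => //; exact/nesym.
- apply/cyc_rot/cyc_rot/zsucc2_cyc => //; [exact/nesym| |].
  + by move=> /(inj _ _ sZ1 Z0)/esym.
  + by move=> /(inj _ _ sZ1 sZ0)/(inj _ _ Z1 Z0).
Qed.

Lemma cross_gap3 z : Z z ->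
  cross [set z; s (s (s z))] [set s (s z); s (s (s (s z)))].
Proof.
move=> Zz; have sZ := zsucc_Z hZ Zz; have ssZ := zsucc_Z hZ sZ.
rewrite setUC; apply: cross_gap2 => //.
- exact: (nesym (zs_neq 1 Zz)).
- exact: (nesym (zs_neq 2 Zz)).
- exact: (nesym (zs_neq 3 Zz)).
Qed.

End Crossings.

(** * The intervals cut out by a decoration *)

Section Decorations.
Local Open Scope classical_set_scope.
Variables (R : realType) (Z : set (R * R)) (hZ : admissible Z).
Variables (n : nat) (hn : (2 <= n)%N) (a : 'I_n -> R * R).
Hypothesis ha : limit_point_enumeration Z a.
Variables (P : {set {set 'I_n}}) (x : 'I_n -> R * R).
Hypothesis hx : decoration Z a P x.
Notation s := (zsucc Z).
Notation gap := (gap Z a).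
Notation U i := (arc_oc Z (a i) (x i)).

(** Points of the closure strictly between consecutive limit points belong to [Z]. The type of [i]
    in the partition is forgotten from here on. *)
Lemma decoration_cases i : gap i (x i) \/ (x i = a i \/ x i = a (ordS i)).
Proof.
have oo : arc_oo Z (a i) (a (ordS i)) (x i) ->
    gap i (x i) \/ (x i = a i \/ x i = a (ordS i)).
  move=> [/(closure_cases ha)[Zx|[k xk]] c]; first by left.
  by case: (a_gap ha (i := i) (k := k)); rewrite -xk.
have [xs xa xo] := hx i.
have [/xs[_ [->|/oo//]]|ns] := pselect (singleton P i); first by right; left.
have [/xa[_ [->|/oo//]]|na] := pselect (adjacency P i); first by right; right.
exact/oo/xo.
Qed.

Lemma gap_limit_neq i k z : gap i z -> z <> a k.
Proof. by move=> [Zz _] e; apply: (a_notin ha (k := k)); rewrite -e. Qed.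

Lemma deco_Z i : Z (x i) -> gap i (x i).
Proof.
by have [//|[]->] := decoration_cases i => /(a_notin ha).
Qed.

Lemma arc_oc_gap i z : Z z -> U i z -> gap i z.
Proof.
move=> Zz [ne [zx|[_ c]]]; first by rewrite zx; apply: deco_Z; rewrite -zx.
split=> //; have [[_ xc]|[e|<-//]] := decoration_cases i; last by case: ne.
exact: cyc_trans c xc.
Qed.

Lemma arc_oc_full i z : x i = a (ordS i) -> gap i z -> U i z.
Proof.
move=> xi [Zz c]; split; first by rewrite xi; exact: (a_neq_next hn ha).
by right; split; [exact: subset_closure|rewrite xi].
Qed.

Lemma arc_oc_end i : Z (x i) -> U i (x i).
Proof.
by move=> /deco_Z ix; split; [exact: (nesym (gap_limit_neq (k := i) ix))|left].
Qed.

Lemma arc_oc_lt i z : gap i z -> cyc (a i) z (x i) -> U i z.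
Proof.
move=> [Zz _] c; split; first by have [] := cyc_neq c.
by right; split=> //; exact: subset_closure.
Qed.

(** The successor remains in the [i]-th gap, which rules out the other intervals, and it is past the
    end of its own. *)
Lemma arc_oc_end_next i j : Z (x i) -> ~ U j (s (x i)).
Proof.
move=> Zx jx; have ix := deco_Z Zx; have isx := gap_zsucc hZ ha ix.
have sZ := zsucc_Z hZ Zx.
have ij : i = j := gap_uniq hZ hn ha isx (arc_oc_gap sZ jx); subst j.
have c := gap_zsucc_cyc hZ ha ix.
case: jx => _ [e|[_ c']]; last exact: cyc_asym c c'.
by have [_ + _] := zsuccP hZ Zx.
Qed.

Lemma arc_oc_reach i z : Z (x i) -> Z z -> U i z -> exists k, iter k s z = x i.
Proof.
move=> Zx Zz iz; apply: (gap_reach hZ ha) (deco_Z Zx) _.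
  exact: arc_oc_gap.
by case: iz => _ [->|[_ c]]; [left|right].
Qed.

(** Going backwards eventually enters the interval. The successor of the iterate is used so that
    both neighbours of the iterate can serve as endpoints of an aisle arc. *)
Lemma arc_oc_back i z : x i <> a i -> gap i z ->
  exists k, U i (s (iter k (zpred Z) z)).
Proof.
move=> xa iz; have isz := gap_zsucc hZ ha iz.
have [ix|[//|xi]] := decoration_cases i; last first.
  by exists 0%N; exact: arc_oc_full.
have Zx := gap_Z ix; have Zz := gap_Z iz; have sZ := gap_Z isz.
have [e|ne] := pselect (s z = x i).
  by exists 0%N; rewrite /= e; exact: arc_oc_end.
have [c|c] := cyc_total (a_circle hZ ha i) (Z_circle hZ sZ) (Z_circle hZ Zx)
    (nesym (gap_limit_neq (k := i) isz)) (nesym (gap_limit_neq (k := i) ix)) ne.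
  by exists 0%N; exact: arc_oc_lt.
have [k kE] := gap_reach hZ ha ix isz (or_intror c).
exists k; suff -> : s (iter k (zpred Z) z) = x i by exact: arc_oc_end.
have it j w : Z w -> Z (iter j s w).
  by move=> Zw; elim: j => //= j; exact: (zsucc_Z hZ).
have pK j w : Z w -> iter j (zpred Z) (iter j s w) = w.
  move=> Zw; elim: j => // j IH.
  by rewrite iterSr [iter j.+1 s w]/= (zsuccK hZ)//; exact: it.
have comm j w : Z w -> s (iter j (zpred Z) w) = iter j (zpred Z) (s w).
  move=> Zw; elim: j => //= j IH.
  have pj : Z (iter j (zpred Z) w) by elim: (j) => //= l; exact: (zpred_Z hZ).
  by rewrite -IH (zpredK hZ)// (zsuccK hZ).
by rewrite comm// -kE pK.
Qed.

Lemma arc_oc_next i z : Z z -> U i z -> z <> x i -> U i (s z).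
Proof.
move=> Zz iz zx; have gz := arc_oc_gap Zz iz.
have [ix|[xi|xi]] := decoration_cases i.
(* Zero steps to [x i] contradict [z <> x i], one step makes [s z] the end itself, and more steps
   leave [s z] strictly before it. *)
- have [[|[|k]] kE] := arc_oc_reach (gap_Z ix) Zz iz => //.
    by move: kE => /= ->; exact: arc_oc_end (gap_Z ix).
  apply: arc_oc_lt; first exact: (gap_zsucc hZ ha).
  by rewrite -kE iterSr; apply: (gap_iter_cyc hZ ha); exact: (gap_zsucc hZ ha).
- by case: iz; rewrite xi.
- exact/arc_oc_full/(gap_zsucc hZ ha gz).
Qed.

Lemma arc_oc_prev i z : Z z -> U i (s z) -> U i z.
Proof.
move=> Zz isz; have := gap_zpred hZ hn ha (arc_oc_gap (zsucc_Z hZ Zz) isz).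
rewrite (zsuccK hZ)// => iz; have c := gap_zsucc_cyc hZ ha iz.
by apply: arc_oc_lt => //; case: isz => _ [<-//|[_ c']]; exact: cyc_trans c c'.
Qed.

Lemma arc_oc_empty i z : x i = a i -> ~ U i z.
Proof. by move=> xi []; rewrite xi. Qed.

End Decorations.

(** * Aisles, coaisles and hearts *)

Section ClusterCategories.
Local Open Scope classical_set_scope.
Local Open Scope ring_scope.
Variables (K : fieldType) (R : realType) (Z : set (R * R)) (hZ : admissible Z).
Variable C : cluster_category K Z.
Notation s := (zsucc Z).
Notation S := (susp C).
Notation D := (desusp C).
Notation obj := (arc_ob C).

Lemma arc_local A : is_arc Z A -> local_end (obj A).
Proof.
move=> Aarc; apply: (indecomposable_local (@cluster_krull_schmidt _ _ _ C)).
exact: arc_ob_indecomposable.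
Qed.

Lemma local_arc (X : C) : local_end X -> exists2 A, is_arc Z A & isom X (obj A).
Proof. by move=> /local_indecomposable; exact: arc_ob_surj. Qed.

Lemma hom_susp_arcP A B : is_arc Z A -> is_arc Z B ->
  (forall f : mor (obj A) (S (obj B)), f = 0) <-> ~ cross A B.
Proof.
move=> Aarc Barc; split=> [AB0 AB|]; last exact: arc_hom_ncross.
have [phi philin [g phig gphi]] := arc_hom_cross C Aarc Barc AB.
have phi0 : phi 0 = 0.
  by have := philin (-1) 0 0; rewrite scaler0 add0r mulN1r addNr.
by have := gphi 1; rewrite (AB0 (g 1)) phi0 => /esym/eqP; rewrite oner_eq0.
Qed.

Lemma susp_zsucc_arc B : is_arc Z B -> isom (S (obj (s @` B))) (obj B).
Proof.
move=> Barc; have := arc_ob_susp C (is_arc_image_zsucc hZ Barc).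
by rewrite (image_zsuccK hZ)//; exact: is_arc_sub.
Qed.

Lemma desusp_arc B : is_arc Z B -> isom (D (obj B)) (obj (s @` B)).
Proof.
move=> Barc; apply: isom_trans (desusp_susp (obj (s @` B))).
by apply: functor_isom; exact/isom_sym/susp_zsucc_arc.
Qed.

(** The object of [B] is the suspension of that of its successor shift, to which the crossing
    criterion applies. *)
Lemma hom_arcP A B : is_arc Z A -> is_arc Z B ->
  (forall f : mor (obj A) (obj B), f = 0) <-> ~ cross A (s @` B).
Proof.
move=> Aarc Barc; have BB := susp_zsucc_arc Barc.
rewrite -(hom_susp_arcP Aarc (is_arc_image_zsucc hZ Barc)); split.
- exact: isom_hom0r (isom_sym BB).
- exact: isom_hom0r BB.
Qed.

(** Mirrors [suspz] on arcs: suspension moves endpoints to predecessors. [Negz m] is minus [m + 1],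
    hence the extra step. *)
Definition shift_arc (k : int) (A : set (R * R)) : set (R * R) :=
  match k with
  | Posz m => iter m (image^~ (zpred Z)) A
  | Negz m => iter m.+1 (image^~ s) A
  end.

Lemma suspz_arc k A : is_arc Z A ->
  is_arc Z (shift_arc k A) /\ isom (suspz k (obj A)) (obj (shift_arc k A)).
Proof.
have iter_arc (F : functor C C) f :
    (forall B, is_arc Z B -> is_arc Z (f @` B) /\ isom (F (obj B)) (obj (f @` B))) ->
    is_arc Z A -> forall m, is_arc Z (iter m (image^~ f) A) /\
      isom (iter m (fob F) (obj A)) (obj (iter m (image^~ f) A)).
  move=> FfE Aarc; elim=> [|m [IHa IHi]]; first by split=> //; exact: isom_refl.
  have [? Fi] := FfE _ IHa; split=> //.
  exact: isom_trans (functor_isom F IHi) Fi.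
case: k => m /iter_arc; apply=> B Barc; split.
- exact: (is_arc_image_zpred hZ).
- exact: arc_ob_susp.
- exact: (is_arc_image_zsucc hZ).
- exact: desusp_arc.
Qed.

Lemma iter_image_mem (f : R * R -> R * R) m A y : A y ->
  iter m (image^~ f) A (iter m f y).
Proof. by move=> Ay; elim: m => //= m IH; exists (iter m f y). Qed.

(** A non-zero object has a local summand, which is an arc, and closure under summands passes the
    membership in all shifts on to it. *)
Lemma nonzero_shift_arc (P : C -> Prop) (A : C) : is_subcategory P ->
  ~ is_zero A -> (forall k, shift_sub k P A) ->
  exists2 B, is_arc Z B & forall k, P (obj (shift_arc k B)).
Proof.
move=> Psub A0 PA.
have [A1 [A2 [/local_arc[B Barc AB] AA]]] :=
  nonzero_local_summand (@cluster_krull_schmidt _ _ _ C) A0.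
exists B => // k.
have := PA (- k); rewrite (shift_subE _ _ Psub) opprK.
move=> /(proj2 Psub _ _ _ (suspz_sum k AA))[PA1 _].
apply: (sub_isom (exists_zero C) Psub _ PA1).
exact: isom_trans (suspz_isom k AB) (proj2 (suspz_arc k Barc)).
Qed.

Lemma shift_sub_arc (P : C -> Prop) B : is_subcategory P -> is_arc Z B ->
  (forall k, P (obj (shift_arc k B))) -> forall k, shift_sub k P (obj B).
Proof.
move=> Psub Barc PB k; apply/shift_subE => //.
apply: (sub_isom (exists_zero C) Psub _ (PB (- k))).
exact/isom_sym/(proj2 (suspz_arc (- k) Barc)).
Qed.

(** * The t-structure of a decorated partition and its degeneracy *)

Variables (n : nat) (hn : (2 <= n)%N) (a : 'I_n -> R * R).
Hypothesis ha : limit_point_enumeration Z a.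
Variable P : {set {set 'I_n}}.
Hypothesis hP : noncrossing P.
Variable x : 'I_n -> R * R.
Hypothesis hx : decoration Z a P x.
Variables X Y : C -> Prop.
Hypothesis hXY : t_structure X Y.
Hypothesis hX : X = aisle a C P x.
Notation gap := (gap Z a).
Notation U i := (arc_oc Z (a i) (x i)).
Notation arcs := (aisle_arcs Z a P x).

Lemma X_sub : is_subcategory X.
Proof. by case: hXY => -[]. Qed.

Lemma Y_sub : is_subcategory Y.
Proof. by case: hXY => -[]. Qed.

(** Arc objects are local, so in the additive closure they are isomorphic to generators, and
    isomorphic arc objects come from the same arc. *)
Lemma aisle_arcP A : is_arc Z A -> X (obj A) <-> arcs A.
Proof.
move=> Aarc; rewrite hX; split=> [XA|arcsA]; last first.
  by apply: add_closure_gen; exists A.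
have [|G [B arcsB ->] AB] := add_closure_local _ (arc_local Aarc) XA.
  by move=> G [B [Barc _] ->]; exact: arc_local.
by rewrite (arc_ob_inj Aarc _ AB)//; case: arcsB.
Qed.

Lemma aisle_hom0 (B : C) :
  (forall A, X A -> forall f : mor A B, f = 0) <->
  (forall A, arcs A -> forall f : mor (obj A) B, f = 0).
Proof.
split=> [B0 A arcsA|B0 A]; first by apply/B0/aisle_arcP => //; case: arcsA.
rewrite hX => XA f.
(* The left orthogonal of the single object [B], written in the form of [left_orth_sub]. *)
apply: (XA (fun A => forall B', B = B' -> forall f : mor A B', f = 0)) => //.
  exact: left_orth_sub.
by move=> _ [A' arcsA' ->] _ <- ; exact: B0.
Qed.

Lemma coaisle_arcP B : is_arc Z B ->
  Y (obj B) <-> forall A, arcs A -> ~ cross A (s @` B).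
Proof.
move=> Barc; rewrite (torsion_pair_orth _ (proj1 hXY)) aisle_hom0.
split=> B0 A arcsA; have Aarc : is_arc Z A by case: arcsA.
- exact/hom_arcP/B0.
- exact/hom_arcP/B0.
Qed.

Lemma shift_coaisle_arcP B : is_arc Z B ->
  shift_sub 1 Y (obj B) <-> forall A, arcs A -> ~ cross A (s @` (s @` B)).
Proof.
move=> Barc; rewrite -coaisle_arcP; last exact: is_arc_image_zsucc.
rewrite (shift_subE _ _ Y_sub).
have BB : isom (suspz (- 1) (obj B)) (obj (s @` B)) by exact: desusp_arc.
have subi := sub_isom (exists_zero C) Y_sub.
by split; apply: subi => //; exact: isom_sym.
Qed.

Lemma aisle_arc_gap A y : arcs A -> A y -> exists2 i, gap i y & U i y.
Proof.
move=> [/is_arc_sub AZ [B _ AB]] Ay; have [i _ iy] := AB y Ay; exists i => //.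
by apply: (arc_oc_gap ha hx) iy; exact: AZ.
Qed.

Lemma aisle_arc2 i y z : U i y -> U i z -> is_arc Z [set y; z] -> arcs [set y; z].
Proof.
move=> iy iz yz; split=> //.
have /finset.bigcupP[B BP iB] : i \in finset.cover P.
  by have [/cover_partition -> _] := hP; rewrite inE.
by exists B => // w [->|->]; exists i.
Qed.

(** Short arcs of a gap stay short arcs of that gap under every shift, which makes them witnesses of
    degeneracy. *)
Lemma shift_arc_gap2 k i z : gap i z ->
  exists2 w, gap i w & shift_arc k [set z; s (s z)] = [set w; s (s w)].
Proof.
move=> iz.
have iter_gap2 f : (forall w, gap i w -> gap i (f w) /\
      f @` [set w; s (s w)] = [set f w; s (s (f w))]) ->
    forall m, exists2 w, gap i w &
      iter m (image^~ f) [set z; s (s z)] = [set w; s (s w)].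
  move=> fE; elim=> [|m [w iw wE]]; first by exists z.
  by have [ifw fw] := fE w iw; exists (f w) => //=; rewrite wE.
case: k => m; apply: iter_gap2 => w iw; rewrite image_setU !image_set1.
- have Zw := gap_Z iw; have sZ := zsucc_Z hZ Zw; split.
    exact: (gap_zpred hZ hn ha).
  by rewrite (zpredK hZ)// (zsuccK hZ).
- by split=> //; exact: (gap_zsucc hZ ha).
Qed.

Lemma left_nondegenerateP :
  t_left_nondegenerate X <-> (forall i, Z (x i) \/ x i = a i).
Proof.
split=> [ndeg i|xi A].
  have [[Zx _]|[->|xi]] := decoration_cases ha hx i; [by left|by right|].
  have [z iz] := gap_inhabited hZ hn ha i.
  have Barc := is_arc_gap2 hZ hn ha (gap_Z iz).
  have [[]] := arc_ob_indecomposable C Barc.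
  apply/ndeg/shift_sub_arc => // [|k]; first exact: X_sub.
  have [w iw wE] := shift_arc_gap2 k iz.
  apply/aisle_arcP; first exact: (proj1 (suspz_arc k Barc)).
  rewrite wE; have Zw := gap_Z iw.
  apply: (@aisle_arc2 i); last exact: (is_arc_gap2 hZ hn ha).
    exact: (arc_oc_full hn ha).
  apply: (arc_oc_full hn ha) => //.
  by do 2!apply: (gap_zsucc hZ ha).
split=> [XA|A0 k]; last exact: shift_sub_zero X_sub A0.
apply: contrapT => A0.
have [B Barc XB] := nonzero_shift_arc X_sub A0 XA.
have {}XB k : arcs (shift_arc k B).
  by apply/aisle_arcP; [exact: (proj1 (suspz_arc k Barc))|exact: XB].
have [y [y' [eB Zy _ _]]] := Barc; have By : B y by rewrite eB; left.
have [i iy Uiy] := aisle_arc_gap (XB 0) By.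
have [Zx|xa] := xi i; last exact: arc_oc_empty xa Uiy.
have [k kE] := arc_oc_reach hZ ha hx Zx Zy Uiy.
(* [Negz k] makes [k + 1] successor steps: [k] to reach [x i] and one to pass it. *)
have mem : shift_arc (Negz k) B (s (x i)).
  by rewrite -kE; exact: (iter_image_mem s k.+1 By).
have [j _] := aisle_arc_gap (XB (Negz k)) mem.
exact: (arc_oc_end_next hZ hn ha hx).
Qed.

Lemma right_nondegenerateP :
  t_right_nondegenerate Y <-> (forall i, Z (x i) \/ x i = a (ordS i)).
Proof.
split=> [ndeg i|xi A].
  have [[Zx _]|[xi|->]] := decoration_cases ha hx i; [by left| |by right].
  have [z iz] := gap_inhabited hZ hn ha i.
  have Barc := is_arc_gap2 hZ hn ha (gap_Z iz).
  have [[]] := arc_ob_indecomposable C Barc.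
  apply/ndeg/shift_sub_arc => // [|k]; first exact: Y_sub.
  have [w iw wE] := shift_arc_gap2 k iz.
  apply/coaisle_arcP; first exact: (proj1 (suspz_arc k Barc)).
  rewrite wE image_setU !image_set1 => A arcsA.
  have isw := gap_zsucc hZ ha iw.
  move=> /(cross_gap2_mem hZ (gap_Z isw))-/(_ (proj1 arcsA)) As.
  have [j jsw Uj] := aisle_arc_gap arcsA As.
  have ij := gap_uniq hZ hn ha (gap_zsucc hZ ha isw) jsw; subst j.
  exact: arc_oc_empty xi Uj.
split=> [YA|A0 k]; last exact: shift_sub_zero Y_sub A0.
apply: contrapT => A0.
have [B Barc YB] := nonzero_shift_arc Y_sub A0 YA.
have {}YB k A' : arcs A' -> ~ cross A' (s @` shift_arc k B).
  exact: ((coaisle_arcP (proj1 (suspz_arc k Barc))).1 (YB k)).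
have [y0 [y' [eB Zy0 _ _]]] := Barc; have By0 : B y0 by rewrite eB; left.
have [i iy0] := gap_exists hZ hn ha Zy0.
have xa : x i <> a i.
  case: (xi i) => [Zx e|->]; first by apply: (a_notin ha (k := i)); rewrite -e.
  exact/nesym/(a_neq_next hn ha).
have [k Uk] := arc_oc_back hZ hn ha hx xa iy0.
have kB := proj1 (suspz_arc k Barc); rewrite /= in kB.
(* The coaisle criterion applies [s] once, so [k + 1] suspensions are needed to speak of the arc
   obtained after [k]. *)
have := YB k.+1; rewrite /= (image_zpredK hZ); last exact: is_arc_sub kB.
have := iter_image_mem (zpred Z) k By0.
move: kB Uk; set y := iter k (zpred Z) y0; set B' := iter k _ _.
move=> B'arc Uy B'y noc.
have Zy : Z y by exact: is_arc_sub B'arc _ B'y.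
have pZ := zpred_Z hZ Zy.
have Uy0 := arc_oc_prev hZ hn ha hx Zy Uy.
have pU : U i (zpred Z y).
  by apply: (arc_oc_prev hZ hn ha hx pZ); rewrite (zpredK hZ).
have [u B'E] : exists u, B' = [set y; u].
  have [b0 [b1 [e _ _ _]]] := B'arc; move: B'y; rewrite e => -[]->.
    by exists b1.
  by exists b0; rewrite setUC.
rewrite {}B'E in B'arc noc; have /(is_arcP hZ)[_ Zu u1 u2 u3] := B'arc.
(* The arc joining the two neighbours of [y] lies in the aisle and crosses the arc from [y] to [u],
   as [u] is neither [y] nor a neighbour of it. *)
have garc := is_arc_gap2 hZ hn ha pZ.
have sp := zpredK hZ Zy.
have := cross_gap2 hZ hn ha pZ Zu; rewrite sp => cr.
rewrite sp in garc; apply: (noc [set zpred Z y; s y]).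
  exact: aisle_arc2 pU Uy garc.
apply: cross_sym; apply: cr => // e.
by apply: u3; rewrite e sp.
Qed.

(** * The simple objects of the heart *)

Definition simple_arc i : set (R * R) := [set zpred Z (zpred Z (x i)); x i].

Lemma simple_arcE i : Z (x i) -> exists2 z, gap i z &
  simple_arc i = [set z; s (s z)] /\ x i = s (s z).
Proof.
move=> Zx; have ix := deco_Z ha hx Zx.
exists (zpred Z (zpred Z (x i))); first by do 2!apply: (gap_zpred hZ hn ha).
by rewrite (zpredK hZ (zpred_Z hZ Zx)) (zpredK hZ Zx).
Qed.

Lemma simple_arc_is_arc i : Z (x i) -> is_arc Z (simple_arc i).
Proof.
by move=> /simple_arcE[z /gap_Z Zz [-> _]]; exact: (is_arc_gap2 hZ hn ha).
Qed.

Lemma heart_arcP A : is_arc Z A ->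
  (X (obj A) /\ shift_sub 1 Y (obj A)) <-> exists2 i, Z (x i) & A = simple_arc i.
Proof.
move=> Aarc; rewrite (aisle_arcP Aarc) (shift_coaisle_arcP Aarc); split.
  move=> [arcsA noc].
  have short y : A = [set y; s (s y)] -> exists2 i, Z (x i) & A = simple_arc i.
    move=> AE; have [_ [B BP AB]] := arcsA.
    have Ay : A y by rewrite AE; left.
    have As : A (s (s y)) by rewrite AE; right.
    have Zy := is_arc_sub Aarc Ay; have Zs := is_arc_sub Aarc As.
    have [i iB Ui] := AB _ As; have sZ := zsucc_Z hZ Zy.
    have [xs|xs] := pselect (s (s y) = x i).
      exists i; first by rewrite -xs.
      by rewrite /simple_arc -xs (zsuccK hZ sZ) (zsuccK hZ Zy).
    (* Unless it ends at [x i], the short arc can be lengthened by one step within its interval; the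
       longer arc crosses the double shift. *)
    have Uy := arc_oc_prev hZ hn ha hx Zy (arc_oc_prev hZ hn ha hx sZ Ui).
    have Usss := arc_oc_next hZ hn ha hx Zs Ui xs.
    have arcs3 := aisle_arc2 Uy Usss (is_arc_gap3 hZ hn ha Zy).
    case: (noc _ arcs3); rewrite AE !image_setU !image_set1.
    exact: (cross_gap3 hZ hn ha Zy).
  have [y0 [y1 [AE Z0 Z1 _]]] := Aarc; subst A.
  have [e|n1] := pselect (y1 = s (s y0)); first by apply: (short y0); rewrite e.
  have [e|n2] := pselect (y0 = s (s y1)).
    by apply: (short y1); rewrite -e setUC.
  case: (noc _ arcsA); rewrite !image_setU !image_set1.
  exact: (cross_shift2 hZ).
move=> [i Zx AE]; have [z iz [e xz]] := simple_arcE Zx; split.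
  have ix := deco_Z ha hx Zx.
  rewrite AE e; apply: (@aisle_arc2 i); last exact: (is_arc_gap2 hZ hn ha (gap_Z iz)).
    by apply: (arc_oc_lt iz); rewrite xz; exact: (gap_iter_cyc hZ ha 1 iz).
  by rewrite -xz; exact: (arc_oc_end ha hx).
move=> A' arcsA'; rewrite AE e !image_setU !image_set1 => cr.
(* The double shift is a short arc with midpoint [s (x i)], and no aisle arc ends there. *)
have Zs : Z (s (s z)) by rewrite -xz.
have := cross_gap2_mem hZ Zs (proj1 arcsA') cr; rewrite -xz => mem.
have [j _] := aisle_arc_gap arcsA' mem.
exact: (arc_oc_end_next hZ hn ha hx).
Qed.

(** The successor shift of [simple_arc j] is short with midpoint [x j], while both ends of
    [simple_arc i] lie in the [i]-th gap. *)
Lemma arc_hom_simple_neq i j : Z (x i) -> Z (x j) -> i <> j ->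
  forall f : mor (obj (simple_arc i)) (obj (simple_arc j)), f = 0.
Proof.
move=> Zi Zj ij; have iarc := simple_arc_is_arc Zi.
apply/(hom_arcP iarc (simple_arc_is_arc Zj)) => cr.
have [z iz [ei xz]] := simple_arcE Zi; have [w jw [ej xw]] := simple_arcE Zj.
have Zsw := zsucc_Z hZ (gap_Z jw).
move: cr; rewrite ej image_setU !image_set1.
move=> /(cross_gap2_mem hZ Zsw iarc); rewrite ei -xw => mem.
have jx := deco_Z ha hx Zj; apply: ij.
apply: (gap_uniq hZ hn ha (z := x j)) jx.
by case: mem => ->//; do 2!apply: (gap_zsucc hZ ha).
Qed.

(** The arc crosses its own successor shift, so its endomorphism space is one-dimensional, spanned
    by the identity. *)
Lemma arc_end_simple i : Z (x i) ->
  forall f : mor (obj (simple_arc i)) (obj (simple_arc i)),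
  exists c, f = c *: idmor _.
Proof.
move=> Zi f; have iarc := simple_arc_is_arc Zi.
have [z iz [ei xz]] := simple_arcE Zi.
have sarc := is_arc_image_zsucc hZ iarc.
have Zz := gap_Z iz; have Zsz := zsucc_Z hZ Zz.
have cr : cross (simple_arc i) (s @` simple_arc i).
  rewrite ei image_setU !image_set1; apply: cross_sym.
  apply: (cross_gap2 hZ hn ha Zz); first by do 2!apply: (zsucc_Z hZ).
  - exact: (iter_zsucc_neq hZ hn ha (k := 2) Zz).
  - exact: (iter_zsucc_neq hZ hn ha (k := 1) Zsz).
  - exact: (iter_zsucc_neq hZ hn ha (k := 0) (zsucc_Z hZ Zsz)).
have [phi philin [g phig _]] := arc_hom_cross C iarc sarc cr.
have [id0 _] := arc_local iarc.
exact: (@one_dim_hom K C _ _ _ phi f (idmor _)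
  (isom_sym (susp_zsucc_arc iarc)) philin (can_inj phig) id0).
Qed.

Lemma nondegenerateP : t_nondegenerate X Y <-> (forall i, Z (x i)).
Proof.
rewrite /t_nondegenerate left_nondegenerateP right_nondegenerateP.
split=> [[xa xb] i|xi]; last by split=> i; left.
have [//|e] := xa i; have [//|e'] := xb i.
(* Outside [Z], [x i] would be two consecutive limit points at once, and these differ because [n] is
   at least two. *)
by case: (a_neq_next hn ha (i := i)); rewrite -e.
Qed.

Notation HXY := (fun A : C => X A /\ shift_sub 1 Y A).

Lemma heart_XY_sub : is_subcategory HXY.
Proof. by apply: heart_sub; case: hXY. Qed.

Lemma heart_local (A : C) : HXY A -> local_end A ->
  exists2 i, Z (x i) & isom A (obj (simple_arc i)).
Proof.
move=> HA /local_arc[B Barc AB].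
have := sub_isom (exists_zero C) heart_XY_sub AB HA.
by move=> /(heart_arcP Barc)[i Zi Bi]; exists i => //; rewrite -Bi.
Qed.

(** Bricks of the heart are labelled by the indices [i] with [x i] in [Z]; the [n] simple modules
    need [n] labels. *)
Lemma heart_equivalent_Z :
  equivalent (heart X Y) (power_module_category K n) -> forall i, Z (x i).
Proof.
move=> eqv; apply: (equivalence_brick_count eqv (weight_line_brick K n)
  (Q := fun (A : heart X Y) i => isom (sval A) (obj (simple_arc i)))).
- by move=> [A HA] /brick_local Aloc; exact: heart_local HA Aloc.
- by move=> A B i AE BE; exact: isom_trans AE (isom_sym BE).
Qed.

(** The simple arcs form a brick family, and Krull-Schmidt decompositions, which stay inside the
    heart, express all its objects as sums of them. *)
Lemma heart_linearly_equivalent : (forall i, Z (x i)) ->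
  linearly_equivalent (heart X Y) (power_module_category K n).
Proof.
move=> Zx; have HS i : HXY (obj (simple_arc i)).
  by apply/heart_arcP; [exact: simple_arc_is_arc|exists i].
pose E i : heart X Y := exist _ (obj (simple_arc i)) (HS i).
have Ebr : brick_family E.
  split=> [i|i|i j f ij].
  - by case: (arc_local (simple_arc_is_arc (Zx i))).
  - exact: arc_end_simple.
  - exact: (arc_hom_simple_neq (Zx i) (Zx j) ij).
apply: (brick_families_equivalence Ebr (weight_line_brick K n)).
- move=> m j; apply: exists_decomposition.
  exact: full_subcategory_additive (tcat_additive C) heart_XY_sub.
- by move=> m j; exists (weight_module K j); exact: weight_module_decomposition.
- move=> [A HA]; apply: finite_sum_decomposition.
  have := @cluster_krull_schmidt _ _ _ C A.
  move=> /(fun h => finite_sum_of_sub heart_XY_sub h HA).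
  move=> /(finite_sum_of_full HA heart_XY_sub).
  apply: finite_sum_of_imp => -[B HB] /= [Bloc _].
  by have [i _ Bi] := heart_local HB Bloc; exists i.
- exact: fdmod_decomposition.
Qed.

End ClusterCategories.

(** * Characterization of non-degeneracy by the decoration and by the heart *)

Local Open Scope classical_set_scope.

Theorem corollary4p19 (K : fieldType) (R : realType)
    (Z : set (R * R)) (hZ : admissible Z)
    (n : nat) (hn : (2 <= n)%N)
    (a : 'I_n -> R * R) (ha : limit_point_enumeration Z a)
    (C : cluster_category K Z)
    (P : {set {set 'I_n}}) (hP : noncrossing P)
    (x : 'I_n -> R * R) (hx : decoration Z a P x)
    (X Y : C -> Prop) (hXY : t_structure X Y) (hX : X = aisle a C P x) :
  [/\ t_left_nondegenerate X <-> (forall i, Z (x i) \/ x i = a i),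
      t_right_nondegenerate Y <-> (forall i, Z (x i) \/ x i = a (ordS i)),
      t_nondegenerate X Y <-> (forall i, Z (x i)),
      t_nondegenerate X Y <->
        linearly_equivalent (heart X Y) (power_module_category K n)
    & t_nondegenerate X Y <->
        equivalent (heart X Y) (power_module_category K n)].
Proof.
have ndeg := nondegenerateP hZ hn ha hP hx hXY hX.
(* The decoration yields a linear equivalence, and any equivalence gives the decoration back, so
   both versions of the heart criterion follow. *)
have heq := heart_linearly_equivalent hZ hn ha hP hx hXY hX.
have hZx := heart_equivalent_Z hZ hn ha hP hx hXY hX.
split.
- exact: (left_nondegenerateP hZ hn ha hP hx hXY hX).
- exact: (right_nondegenerateP hZ hn ha hP hx hXY hX).
- exact: ndeg.
- by rewrite ndeg; split=> [/heq//|/linearly_equivalent_equivalent/hZx].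
- by rewrite ndeg; split=> [/heq/linearly_equivalent_equivalent//|/hZx].
Qed.
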